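(* Let $M$ be a 3-dimensional spherical CR manifold with a CR triangulation $M=\Delta_1\cup\cdots\cup\Delta_k$ (ideal if $M$ is non-compact), and let $$\beta(M)=\sum_{s=1}^k\left([z^s_{01}]+[z^s_{10}]+[z^s_{23}]+[z^s_{32}]\right)\in\mathcal{P}(\mathbb{C}),$$ where $z^s_{ij}$ are the cross-ratio invariants of the vertices $(p_0^s,p_1^s,p_2^s,p_3^s)$ of $\Delta_s$, ordered consistently with the orientation. Then $D(\beta(M))=0$, where $D:\mathcal{P}(\mathbb{C})\to\mathbb{R}$ is induced by the Bloch–Wigner function.
   Context: Pre-Bloch group: for a field $F$, $\mathcal{P}(F)$ is the quotient of the free abelian group $\mathbb{Z}[F\setminus\{0,1\}]$ by the subgroup generated by $[x]-[y]+[\frac{y}{x}]-[\frac{1-x^{-1}}{1-y^{-1}}]+[\frac{1-x}{1-y}]$ for $x\neq y$ in $F\setminus\{0,1\}$. Bloch–Wigner function: $D(x)=\arg(1-x)\log|x|-\operatorname{Im}\left(\int_0^x\log(1-t)\frac{dt}{t}\right)$, well defined and real analytic on $\mathbb{C}\setminus\{0,1\}$, apart from real analyticity extended continuously to $\mathbb{C}P^1$ by $D(0)=D(1)=D(\infty)=0$. It satisfies the 5-term relation, so $\sum n_i[x_i]\mapsto\sum n_iD(x_i)$ is well defined on $\mathcal{P}(\mathbb{C})$. $\mathbb{C}^{2,1}$ is $\mathbb{C}^3$ with the Hermitian form $\langle z,w\rangle=w^*Jz$, $J=\begin{pmatrix}0&0&1\\0&1&0\\1&0&0\end{pmatrix}$.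 $S^3\subset\mathbb{C}P^2$ is the set of null lines, and $PU(2,1)$ is the projectivized unitary group of this form. A $\mathbb{C}$-circle is the intersection with $S^3$ of a complex projective line which meets $S^3$ in more than one point. Four points of $S^3$ are generic if they are pairwise distinct and no three of them lie on a common $\mathbb{C}$-circle. Cross-ratio invariants: for a generic quadruple $(p_0,p_1,p_2,p_3)$, with lifts $\hat p_i\in\mathbb{C}^{2,1}$, and $(i,j,k,l)$ an even permutation of $(0,1,2,3)$, $$z_{ij}=\frac{\langle \hat p_l,c_{ij}\rangle\langle\hat p_k,\hat p_i\rangle}{\langle\hat p_k,c_{ij}\rangle\langle\hat p_l,\hat p_i\rangle}\in\mathbb{C}\setminus\{0,1\},$$ where $c_{ij}\neq0$ satisfies $\langle\hat p_i,c_{ij}\rangle=\langle\hat p_j,c_{ij}\rangle=0$. A spherical CR manifold is a 3-manifold with an $(S^3,PU(2,1))$-geometric structure. A CR tetrahedron is a tetrahedron whose vertices are given by a generic quadruple of points of $S^3$. A CR triangulation of $M$ is a (possibly singular) triangulation by finitely many tetrahedra, such that, developing the triangulation in $S^3$ (equivariantly for the holonomy representation $\pi_1(M)\to PU(2,1)$), every tetrahedron becomes a CR tetrahedron; the faces are glued in pairs by elements of $PU(2,1)$. Ideal: $M$ is the interior of a compact manifold with boundary, the tetrahedra triangulate the space obtained by collapsing each boundary component to a point, and the vertices are exactly these collapsed points. *)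

(* Defs.v *)
From HB Require Import structures.
From mathcomp Require Import all_boot all_order all_algebra all_fingroup.
From mathcomp Require Import generic_quotient ring_quotient.
From mathcomp.multinomials Require Import freeg.
From mathcomp Require Import complex.
From mathcomp Require Import all_classical all_reals all_analysis.
From Stdlib Require Import Relation_Operators.
Import numFieldNormedType.Exports.

Set Implicit Arguments.
Unset Strict Implicit.
Unset Printing Implicit Defensive.

Import Order.TTheory GRing.Theory Num.Theory.

Local Open Scope ring_scope.
Local Open Scope classical_set_scope.
Local Open Scope quotient_scope.

Definition punctured (F : fieldType) : choiceType :=
  {x : F | (x != 0) && (x != 1)}.

(* The generator [x]; it is 0 for the junk values x = 0, 1. *)
Definition gen (F : fieldType) (x : F) : {freeg (punctured F) / int} :=
  if insub x is Some u then Freeg [:: (1, u)] else 0.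

Definition five_term (F : fieldType) (x y : F) :
    {freeg (punctured F) / int} :=
  gen x - gen y + gen (y / x) - gen ((1 - x^-1) / (1 - y^-1))
  + gen ((1 - x) / (1 - y)).

Definition five_term_subgroup (F : fieldType) :
    {pred {freeg (punctured F) / int}} :=
  fun g => `[< forall H : {pred {freeg (punctured F) / int}}, zmod_closed H ->
    (forall x y : F, x != 0 -> x != 1 -> y != 0 -> y != 1 -> x != y ->
       five_term x y \in H) ->
    g \in H >].

Fact five_term_subgroup_closed (F : fieldType) :
  zmod_closed (@five_term_subgroup F).
Proof.
split; first by apply/asboolP => H [].
move=> u v /asboolP uH /asboolP vH; apply/asboolP => H HZ HR.
by case: (HZ) => _; apply; [exact: uH | exact: vH].
Qed.

HB.instance Definition _ (F : fieldType) :=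
  GRing.isZmodClosed.Build _ (@five_term_subgroup F)
    (@five_term_subgroup_closed F).

Definition preBloch (F : fieldType) : zmodType :=
  Quotient.quot (@five_term_subgroup F).

Definition bloch (F : fieldType) (x : F) : preBloch F :=
  \pi_(Quotient.quot (@five_term_subgroup F)) (gen x).

(* R[i] with a structure from which the topology is inferred. *)
Definition C (R : realType) : numClosedFieldType := R[i].

Section BlochWigner.
Variable R : realType.
Implicit Types (x z : C R) (f : C R -> C R).

Definition re z : R := complex.Re z.
Definition im z : R := complex.Im z.
Definition modulus z : R := ComplexField.Normc.normc z.

(* Principal values, in ]-pi, pi]. *)
Definition Carg z : R :=
  let t := acos (re z / modulus z) in if 0 <= im z then t else - t.

Definition Clog z : C R := Complex (ln (modulus z)) (Carg z).

(* Integral of f along the segment from 0 to x. *)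
Definition segment_integral f x : C R :=
  let g (s : R) := f ((Complex s 0 : C R) * x) * x in
  Complex (\int[lebesgue_measure]_(s in `[0%R, 1%R]) re (g s))
          (\int[lebesgue_measure]_(s in `[0%R, 1%R]) im (g s)).

(* With principal branches, and the integral taken along the segment [0, x],
   the branches of arg and log agree as they must: arg (1 - x) is the value at
   t = x of Im log (1 - t).  For real x > 1 the two terms are both
   pi * ln x, and for x = 0, 1 both vanish, so that the formula also gives the
   values of the continuous extension there. *)
Definition BlochWigner x : R :=
  Carg (1 - x) * ln (modulus x)
  - im (segment_integral (fun t => Clog (1 - t) / t) x).

End BlochWigner.

Section Sphere.
Variable R : realType.

Definition J : 'M[C R]_3 := \matrix_(i, j) (i + j == 2)%N%:R.

Definition adjoint m n (A : 'M[C R]_(m, n)) : 'M[C R]_(n, m) :=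
  (map_mx Num.conj A)^T.

Definition herm (z w : 'cV[C R]_3) : C R := (adjoint w *m J *m z) 0 0.

Definition nonzero_vectors : set 'cV[C R]_3 := [set v | v != 0].

Definition collinear : rel (set_type nonzero_vectors) :=
  fun u v => `[< exists a : C R, \val u = a *: \val v >].

Fact collinear_equiv : equiv_class_of collinear.
Proof.
have sym u v : collinear u v -> collinear v u.
  move=> /asboolP[a uv]; apply/asboolP; exists a^-1.
  rewrite uv scalerA mulVf ?scale1r //; apply/eqP => a0.
  have /negP := set_mem (valP u); apply.
  by rewrite uv a0 scale0r eqxx.
split.
- by move=> u; apply/asboolP; exists 1; rewrite scale1r.
- by move=> u v; apply/idP/idP => /sym.
- move=> v u w /asboolP[a uv] /asboolP[b vw]; apply/asboolP.
  by exists (a * b); rewrite -scalerA -vw.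
Qed.

Canonical collinear_equiv_rel := EquivRelPack collinear_equiv.

Definition CP2 : topologicalType :=
  quotient_topology {eq_quot collinear_equiv_rel}.

(* A nonzero vector representing the point. *)
Definition lift_CP2 (p : CP2) : 'cV[C R]_3 :=
  \val (repr (p : {eq_quot collinear_equiv_rel})).

Definition null_lines : set CP2 :=
  [set p | herm (lift_CP2 p) (lift_CP2 p) = 0].

Definition S3 : topologicalType := set_type null_lines.

Definition hat (p : S3) : 'cV[C R]_3 := lift_CP2 (\val p).

Definition U21 : set 'M[C R]_3 := [set A | adjoint A *m J *m A = J].

(* PU(2,1) acts faithfully on S3, so that its elements are represented by the
   transformations of S3 which they induce. *)
Definition PU21 : set (S3 -> S3) :=
  [set g | exists2 A, U21 A &
     forall p, exists a : C R, hat (g p) = a *: (A *m hat p)].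

Definition Ccircle (K : set S3) : Prop :=
  exists L : {vspace 'cV[C R]_3},
    [/\ \dim L = 2%N, K = [set p | hat p \in L] &
        exists p q, [/\ K p, K q & p <> q]].

Definition generic (p : 'I_4 -> S3) : Prop :=
  injective p /\
  forall i j k : 'I_4, i != j -> j != k -> i != k ->
    ~ exists K, [/\ Ccircle K, K (p i), K (p j) & K (p k)].

(* c_ij, which is unique up to a nonzero scalar for distinct points. *)
Definition polar (p q : S3) : 'cV[C R]_3 :=
  xget 0 [set c | [/\ c != 0, herm (hat p) c = 0 & herm (hat q) c = 0]].

(* The invariant z_ij, for (i, j, k, l) an even permutation of (0, 1, 2, 3). *)
Definition cross_ratio (p : 'I_4 -> S3) (i j k l : 'I_4) : C R :=
  let c := polar (p i) (p j) in
  (herm (hat (p l)) c * herm (hat (p k)) (hat (p i)))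
  / (herm (hat (p k)) c * herm (hat (p l)) (hat (p i))).

Definition z01 p := cross_ratio p (inord 0) (inord 1) (inord 2) (inord 3).
Definition z10 p := cross_ratio p (inord 1) (inord 0) (inord 3) (inord 2).
Definition z23 p := cross_ratio p (inord 2) (inord 3) (inord 0) (inord 1).
Definition z32 p := cross_ratio p (inord 3) (inord 2) (inord 1) (inord 0).

End Sphere.

(* f restricts to a homeomorphism from the open set U onto an open set. *)
Definition chart_on (X Y : topologicalType) (U : set X) (f : X -> Y) : Prop :=
  [/\ open U, {in U &, injective f}, {in U, continuous f} &
      forall W, open W -> W `<=` U -> open (f @` W)].

Section CompactManifold.
Variables (R : realType) (N : topologicalType).

Definition half_space : set 'rV[R]_3 := [set x | 0 <= x 0 0].

Definition compact_3manifold_with_boundary : Prop :=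
  [/\ hausdorff_space N, compact [set: N] &
      forall n : N, exists (U : set N) (f : N -> set_type half_space),
        U n /\ chart_on U f].

Definition manifold_interior : set N :=
  [set n | exists (U : set N) (f : N -> 'rV[R]_3), U n /\ chart_on U f].

Definition manifold_boundary : set N := ~` manifold_interior.

End CompactManifold.

Section Coverings.
Variables (R : realType) (E B : topologicalType) (p : E -> B).

Definition covering : Prop :=
  [/\ continuous p, range p = setT &
      forall b, exists U : set B,
        [/\ open U, U b & exists (I : Type) (V : I -> set E),
          [/\ p @^-1` U = \bigcup_i V i, trivIset setT V &
              forall i, chart_on (V i) p /\ p @` V i = U]]].

Definition simply_connected : Prop :=
  (forall x y : E, exists f : R -> E,
     [/\ {within `[0%R, 1%R], continuous f}, f 0 = x & f 1 = y]) /\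
  (forall f : R -> E, {within `[0%R, 1%R], continuous f} -> f 0 = f 1 ->
     exists H : R * R -> E,
       {within `[0%R, 1%R] `*` `[0%R, 1%R], continuous H} /\
       forall t, 0 <= t <= 1 ->
         [/\ H (0, t) = f t, H (1, t) = f 0, H (t, 0) = f 0 & H (t, 1) = f 0]).

Definition deck (g : E -> E) : Prop :=
  [/\ continuous g, p \o g = p &
      exists h : E -> E, [/\ continuous h, cancel g h & cancel h g]].

End Coverings.

(* An (S3, PU(2,1))-structure is given by an atlas of pairs (U, phi). *)
Record sphericalCR (R : realType) := SphericalCR {
  carrier :> topologicalType;
  carrier_hausdorff : hausdorff_space carrier;
  carrier_countable : @second_countable carrier;
  carrier_connected : connected [set: carrier];
  atlas : set (set carrier * (carrier -> S3 R));
  atlas_cover : forall x, exists2 c, atlas c & c.1 x;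
  atlas_chart : forall c, atlas c -> chart_on c.1 c.2;
  atlas_transition : forall c c', atlas c -> atlas c' ->
    forall x, c.1 x -> c'.1 x ->
    exists2 g, PU21 g & \forall y \near x, c'.2 y = g (c.2 y)
}.

(* A universal covering of M, on which pi_1(M) acts by deck transformations
   (simply transitively on the fibres), with a developing map and its holonomy
   representation. *)
Record development (R : realType) (M : sphericalCR R) := Development {
  ucover : topologicalType;
  proj : ucover -> M;
  proj_covering : covering proj;
  ucover_simply_connected : simply_connected R ucover;
  deck_transitive : forall y y', proj y = proj y' ->
    exists2 g, deck proj g & g y = y';
  dev : ucover -> S3 R;
  dev_chart : forall y c, atlas c -> c.1 (proj y) ->
    exists2 g, PU21 g & \forall z \near y, dev z = g (c.2 (proj z));
  hol : (ucover -> ucover) -> (S3 R -> S3 R);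
  hol_PU21 : forall g, deck proj g -> PU21 (hol g);
  hol_comp : forall g h, deck proj g -> deck proj h ->
    hol (g \o h) = hol g \o hol h;
  dev_equivariant : forall g y, deck proj g -> dev (g y) = hol g (dev y)
}.

(* Oriented face pairings of the tetrahedra 0, ..., ntet - 1, each with vertices
   0, ..., 3.  If glue (s, i) = (s', t), then the face of s opposite to its
   vertex i is glued to the face of s' opposite to t i, each vertex a != i of s
   being sent to the vertex t a of s'.  The vertices are ordered consistently
   with an orientation exactly when every pairing reverses the orientations of
   the faces, i.e., when every t is odd. *)
Record face_pairing := FacePairing {
  ntet : nat;
  glue : 'I_ntet * 'I_4 -> 'I_ntet * {perm 'I_4};
  glue_invol : forall s i,
    glue ((glue (s, i)).1, (glue (s, i)).2 i) = (s, ((glue (s, i)).2^-1)%g);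
  glue_free : forall s i, ((glue (s, i)).1, (glue (s, i)).2 i) <> (s, i);
  glue_oriented : forall s i, odd_perm (glue (s, i)).2
}.

Section Triangulation.
Variable R : realType.

(* Points of a tetrahedron are given by their barycentric coordinates. *)
Definition simplex : set 'rV[R]_4 :=
  [set x | (forall i, 0 <= x 0 i) /\ \sum_i x 0 i = 1].

Definition face (i : 'I_4) : set 'rV[R]_4 := [set x | simplex x /\ x 0 i = 0].

Definition vertex (a : 'I_4) : 'rV[R]_4 := delta_mx 0 a.

(* The affine map sending each vertex a to the vertex t a. *)
Definition relabel (t : {perm 'I_4}) (x : 'rV[R]_4) : 'rV[R]_4 :=
  col_perm t^-1%g x.

Variable P : face_pairing.

Definition glue_step (u v : 'I_(ntet P) * 'rV[R]_4) : Prop :=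
  exists i, face i u.2 /\
    v = ((glue (u.1, i)).1, relabel (glue (u.1, i)).2 u.2).

(* X is the (possibly singular) union of the tetrahedra, with characteristic
   maps sigma.  As X is Hausdorff, it has the quotient topology. *)
Definition triangulation (X : topologicalType)
    (sigma : 'I_(ntet P) -> 'rV[R]_4 -> X) : Prop :=
  [/\ hausdorff_space X,
      forall s, {within simplex, continuous (sigma s)},
      forall q, exists s, exists2 x, simplex x & sigma s x = q &
      forall s x s' x', simplex x -> simplex x' ->
        sigma s x = sigma s' x' <->
        clos_refl_trans _ glue_step (s, x) (s', x')].

Definition vertices (X : Type) (sigma : 'I_(ntet P) -> 'rV[R]_4 -> X) : set X :=
  [set q | exists s a, q = sigma s (vertex a)].

End Triangulation.

(* M is the interior of a compact manifold N with boundary, X is obtained from N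
   by collapsing each component of the boundary to a point, V is the set of
   these points, and e is the inclusion of M in X. *)
Definition ideal_completion (R : realType) (M X : topologicalType)
    (e : M -> X) (V : set X) : Prop :=
  exists (N : topologicalType) (j : M -> N) (q : N -> X),
    let bd := @manifold_boundary R N in
    [/\ compact_3manifold_with_boundary R N,
        chart_on setT j /\ range j = @manifold_interior R N,
        [/\ range q = setT, forall U, open U <-> open (q @^-1` U) &
            forall n n', q n = q n' <->
              n = n' \/ bd n /\ connected_component bd n n'],
        e = q \o j & V = q @` bd].

(* The triangulated space is X, which is M itself if M is compact.  The
   triangulation is developed by lifting each tetrahedron (without its ideal
   vertices) to the universal covering by a map tlift s; all its lifts are then
   the maps g \o tlift s, for g in pi_1(M).  The developed vertices of the lift
   g \o tlift s are the points hol g (vert s a), where vert s a is the developed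
   image of the vertex a of tlift s: it is given by the developing map if the
   vertex is not ideal (vert_dev), and it is the same for all the lifted
   tetrahedra which share the vertex (vert_glue).  In particular the faces are
   glued in pairs by the elements hol g of PU(2,1). *)
Record CR_triangulation (R : realType) (M : sphericalCR R) :=
    CRTriangulation {
  space : topologicalType;
  incl : M -> space;
  pairing : face_pairing;
  char_map : 'I_(ntet pairing) -> 'rV[R]_4 -> space;
  char_mapP : triangulation char_map;
  closed_or_ideal :
    (compact [set: M] /\ chart_on setT incl /\ range incl = setT) \/
    (~ compact [set: M] /\ ideal_completion R incl (vertices char_map));
  develop : development M;
  non_ideal s : set 'rV[R]_4 :=
    [set x | simplex x /\ range incl (char_map s x)];
  tlift : 'I_(ntet pairing) -> 'rV[R]_4 -> ucover develop;
  tlift_continuous : forall s, {within non_ideal s, continuous (tlift s)};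
  tlift_proj : forall s x, non_ideal s x ->
    incl (proj (tlift s x)) = char_map s x;
  vert : 'I_(ntet pairing) -> 'I_4 -> S3 R;
  vert_dev : forall s a, non_ideal s (vertex R a) ->
    vert s a = dev (tlift s (vertex R a));
  vert_glue : forall s i g, deck (@proj _ _ develop) g ->
    (forall x, non_ideal s x -> face i x ->
       g (tlift (glue (s, i)).1 (relabel (glue (s, i)).2 x)) = tlift s x) ->
    forall a, a != i ->
      vert s a = hol g (vert (glue (s, i)).1 ((glue (s, i)).2 a));
  vert_generic : forall s, generic (vert s)
}.

Definition beta (R : realType) (M : sphericalCR R) (T : CR_triangulation M) :
    preBloch (C R) :=
  \sum_(s < ntet (pairing T))
    (bloch (z01 (vert s)) + bloch (z10 (vert s))
     + bloch (z23 (vert s)) + bloch (z32 (vert s))).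

(* Main.v *)
Require Import Defs.
From HB Require Import structures.
From mathcomp.multinomials Require Import freeg.
From mathcomp Require Import all_boot all_order all_algebra all_fingroup.
From mathcomp Require Import complex.
From mathcomp Require Import generic_quotient ring_quotient.
From mathcomp Require Import all_classical all_reals all_analysis.
From mathcomp Require Import measurable_realfun ring lra.
From Stdlib Require Import Relation_Operators.
Import numFieldNormedType.Exports.
Set Implicit Arguments.
Unset Strict Implicit.
Unset Printing Implicit Defensive.
Import Order.TTheory GRing.Theory Num.Theory.
Local Open Scope ring_scope.
Local Open Scope classical_set_scope.

(* Along a path g in C \ {0, 1}, the derivative of D(g) is
     - ln|g| Im(g' / (1 - g)) - ln|1 - g| Im(g' / g).
   Off the cut [1, +oo[ this is differentiation under the integral sign, and the
   relation D(1/x) = - D(x) carries the formula across the cut.  Hence the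
   five-term expression has zero derivative; moving its arguments along segments
   to real points, where D vanishes, shows that it is zero.

   Lift the vertices of a CR tetrahedron to null vectors with
   p3 = p0 + p1 + p2.  In terms of a = <p1, p0>, b = <p2, p0>, d = <p2, p1>, for
   which Re (a + b + d) = 0, six five-term relations and D(conj x) = - D(x) turn
   2 (D(z01) + D(z10) + D(z23) + D(z32)) into the alternating sum over the faces
   (p, q, r) of D(- u / conj u), where u = <p, q> <q, r> <r, p>.  This term is
   alternating in p, q, r and invariant under PU(2,1).

   A face minus its ideal vertices is connected, so that its lifts coming from
   the two adjacent tetrahedra differ by a deck transformation g, and hol g maps
   the developed vertices of one face to those of the other.  As the pairings
   reverse orientation, the terms of paired faces cancel. *)

(** * Paths of complex numbers and the branches of the logarithm *)

(** In terms of log|z| and arg, the derivative of D is bilinear and alternating in the pair z, 1 -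
    z. The five-term relation thus reduces to an identity between logarithmic derivatives. The
    principal branches jump on [1, +oo[, although D does not: the values of D there are computed
    directly from the integral. The unit number - u / conj u is - exp(2iA), with A the Cartan
    angular invariant of the triple, so a face contributes only through A. The normalization of p3
    uses up the freedom of scaling the lifts, apart from a common factor; the relation on real parts
    is <p3, p3> = 0. The factor 2 arises because four of the six relations give V = Y + (faces),
    where V is the sum of the four values and Y a sum of auxiliary ones, while the other two give Y
    = - V. Some arguments in these relations have a denominator containing b conj a - a d, which may
    be zero for a generic quadruple. This is why D is extended by 0 to the points 0 and 1, and the
    five-term relation to all arguments. *)

Section ComplexPaths.
Variable R : realType.
Implicit Types (x y z : C R) (t s : R).

Lemma re_eq_im_eq x y : re x = re y -> im x = im y -> x = y.
Proof. by case: x y => [a b] [c d] /= -> ->. Qed.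

Lemma reD x y : re (x + y) = re x + re y. Proof. by case: x y => [a b] [c d]. Qed.
Lemma imD x y : im (x + y) = im x + im y. Proof. by case: x y => [a b] [c d]. Qed.
Lemma reN x : re (- x) = - re x. Proof. by case: x. Qed.
Lemma imN x : im (- x) = - im x. Proof. by case: x. Qed.
Lemma reM x y : re (x * y) = re x * re y - im x * im y.
Proof. by case: x y => [a b] [c d]. Qed.
Lemma imM x y : im (x * y) = re x * im y + im x * re y.
Proof. by case: x y => [a b] [c d]. Qed.
Lemma re1 : re (1 : C R) = 1. Proof. by []. Qed.
Lemma im1 : im (1 : C R) = 0. Proof. by []. Qed.
Lemma reV x : re x^-1 = re x / (re x ^+ 2 + im x ^+ 2).
Proof. by case: x. Qed.
Lemma imV x : im x^-1 = - (im x / (re x ^+ 2 + im x ^+ 2)).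
Proof. by case: x. Qed.

Definition cE := (reD, imD, reN, imN, reM, imM, reV, imV, re1, im1).

Lemma modulusE x : modulus x = Num.sqrt (re x ^+ 2 + im x ^+ 2).
Proof. by case: x. Qed.

Lemma sqrD_gt0 (a b : R) : (0 < a ^+ 2 + b ^+ 2) = (a != 0) || (b != 0).
Proof.
rewrite lt0r addr_ge0 ?sqr_ge0// andbT paddr_eq0 ?sqr_ge0// !sqrf_eq0.
by rewrite negb_and.
Qed.

Lemma normsq_gt0 x : x != 0 -> 0 < re x ^+ 2 + im x ^+ 2.
Proof. by case: x => a b; rewrite sqrD_gt0 eq_complex /= negb_and. Qed.

Lemma modulus_gt0 x : x != 0 -> 0 < modulus x.
Proof. by move=> /normsq_gt0 ?; rewrite modulusE sqrtr_gt0. Qed.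

Lemma modulusM x y : modulus (x * y) = modulus x * modulus y.
Proof. exact: ComplexField.Normc.normcM. Qed.

Lemma modulusV x : modulus x^-1 = (modulus x)^-1.
Proof. exact: ComplexField.Normc.normcV. Qed.

Definition is_cderive (g : R -> C R) t (dg : C R) :=
  is_derive t 1 (fun s => re (g s)) (re dg) /\
  is_derive t 1 (fun s => im (g s)) (im dg).

Lemma is_derive_fM (f g : R -> R) t df dg :
  is_derive t 1 f df -> is_derive t 1 g dg ->
  is_derive t 1 (fun s => f s * g s) (f t * dg + g t * df).
Proof. by move=> Hf Hg; exact: (is_deriveM Hf Hg). Qed.

Lemma is_derive_fcst (c : R) t : is_derive t 1 (fun=> c) 0.
Proof. exact: is_derive_cst. Qed.

Lemma is_derive_fD (f g : R -> R) t df dg :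
  is_derive t 1 f df -> is_derive t 1 g dg ->
  is_derive t 1 (fun s => f s + g s) (df + dg).
Proof. by move=> Hf Hg; exact: (is_deriveD Hf Hg). Qed.

Lemma is_derive_fN (f : R -> R) t df :
  is_derive t 1 f df -> is_derive t 1 (fun s => - f s) (- df).
Proof. by move=> Hf; exact: (is_deriveN Hf). Qed.

Lemma is_derive_fcomp (f g : R -> R) t df dg :
  is_derive t 1 g dg -> is_derive (g t) 1 f df ->
  is_derive t 1 (fun s => f (g s)) (df * dg).
Proof. by move=> Hg Hf; exact: (is_derive1_comp Hf Hg). Qed.

Lemma is_derive_fX2 (f : R -> R) t df :
  is_derive t 1 f df -> is_derive t 1 (fun s => f s ^+ 2) (2 * f t * df).
Proof.
by move=> Hf; apply: (is_derive_eq (is_derive_fM Hf Hf)); ring.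
Qed.

Lemma is_derive_fV (f : R -> R) t df : f t != 0 ->
  is_derive t 1 f df -> is_derive t 1 (fun s => (f s)^-1) (- df / f t ^+ 2).
Proof.
move=> f0 Hf; apply: (is_derive_eq (is_deriveV f0 Hf)).
by rewrite /GRing.scale /=; ring.
Qed.

Lemma is_derive_near_eq (f g : R -> R) t df :
  (\forall s \near t, f s = g s) -> is_derive t 1 f df -> is_derive t 1 g df.
Proof. by move=> fg Hf; exact: (near_eq_is_derive fg Hf). Qed.

Lemma is_cderive_eq (g : R -> C R) t dg dg' :
  is_cderive g t dg -> dg = dg' -> is_cderive g t dg'.
Proof. by move=> + <-. Qed.

Lemma is_cderive_cst x t : is_cderive (fun=> x) t 0.
Proof. by split; apply: is_derive_cst. Qed.

Lemma is_cderiveD (g h : R -> C R) t dg dh :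
  is_cderive g t dg -> is_cderive h t dh ->
  is_cderive (fun s => g s + h s) t (dg + dh).
Proof.
move=> [g1 g2] [h1 h2]; split; rewrite cE.
- by under eq_fun do rewrite cE; exact: is_derive_fD.
- by under eq_fun do rewrite cE; exact: is_derive_fD.
Qed.

Lemma is_cderiveN (g : R -> C R) t dg :
  is_cderive g t dg -> is_cderive (fun s => - g s) t (- dg).
Proof.
move=> [g1 g2]; split; rewrite cE.
- by under eq_fun do rewrite cE; exact: is_derive_fN.
- by under eq_fun do rewrite cE; exact: is_derive_fN.
Qed.

Lemma is_cderiveM (g h : R -> C R) t dg dh :
  is_cderive g t dg -> is_cderive h t dh ->
  is_cderive (fun s => g s * h s) t (g t * dh + dg * h t).
Proof.
move=> [g1 g2] [h1 h2]; split; rewrite !cE.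
- under eq_fun do rewrite cE.
  apply: (is_derive_eq (is_derive_fD (is_derive_fM g1 h1)
    (is_derive_fN (is_derive_fM g2 h2)))); ring.
- under eq_fun do rewrite cE.
  apply: (is_derive_eq (is_derive_fD (is_derive_fM g1 h2)
    (is_derive_fM g2 h1))); ring.
Qed.

Lemma is_cderiveV (g : R -> C R) t dg : g t != 0 ->
  is_cderive g t dg -> is_cderive (fun s => (g s)^-1) t (- dg / g t ^+ 2).
Proof.
move=> g0 [g1 g2].
have n0 := lt0r_neq0 (normsq_gt0 g0).
have dn := @is_derive_fV (fun s => re (g s) ^+ 2 + im (g s) ^+ 2) _ _ n0
  (is_derive_fD (is_derive_fX2 g1) (is_derive_fX2 g2)).
have e : - dg / g t ^+ 2 = (- dg * (g t)^-1) * (g t)^-1.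
  by rewrite expr2 invfM mulrA.
rewrite e; split; rewrite !cE.
- under eq_fun do rewrite cE.
  by apply: (is_derive_eq (is_derive_fM g1 dn)); field.
- under eq_fun do rewrite cE.
  by apply: (is_derive_eq (is_derive_fN (is_derive_fM g2 dn))); field.
Qed.

Definition rc t : C R := Complex t 0.

Lemma is_cderive_affine x y t : is_cderive (fun s => x + rc s * y) t y.
Proof.
have drc : is_cderive rc t 1 by split; [exact: is_derive_id|exact: is_derive_cst].
apply: (is_cderive_eq (is_cderiveD (is_cderive_cst x t)
  (is_cderiveM drc (is_cderive_cst y t)))).
by rewrite mulr0 !add0r mul1r.
Qed.

Lemma is_derive_lnmod (g : R -> C R) t dg : g t != 0 ->
  is_cderive g t dg ->
  is_derive t 1 (fun s => ln (modulus (g s))) (re (dg / g t)).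
Proof.
move=> g0 [g1 g2].
have n0 := normsq_gt0 g0.
have m0 := modulus_gt0 g0; rewrite modulusE in m0.
under eq_fun do rewrite modulusE.
have dn := is_derive_fD (is_derive_fX2 g1) (is_derive_fX2 g2).
apply: (is_derive_eq (is_derive_fcomp (is_derive_fcomp dn (is_derive1_sqrt n0))
  (is_derive1_ln m0))).
rewrite !cE; set n := re (g t) ^+ 2 + im (g t) ^+ 2.
rewrite -/n in m0 n0.
have e : Num.sqrt n ^+ 2 = n by rewrite sqr_sqrtr ?ltW.
set m := Num.sqrt n in e m0 *; clearbody m.
by rewrite -e; field; rewrite lt0r_neq0.
Qed.

End ComplexPaths.

Section ComplexLog.
Variable R : realType.
Implicit Types (x y z : C R) (t s : R).

Lemma is_derive_cvg (f : R -> R) t df : is_derive t 1 f df -> f s @[s --> t] --> f t.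
Proof.
by move=> Hf; apply/differentiable_continuous/derivable1_diffP; exact: ex_derive.
Qed.

(** The plane cut along ]-oo, 0], on which the principal argument is differentiable. *)
Definition slit z := (0 < re z) || (im z != 0).

Lemma slit_neq0 z : slit z -> z != 0.
Proof. by move=> h; apply/eqP => z0; move: h; rewrite z0 /slit /= ltxx eqxx. Qed.

Lemma slit_add_gt0 z : slit z -> 0 < modulus z + re z.
Proof.
move=> /orP[h|h]; first by rewrite ltr_wpDl// modulusE sqrtr_ge0.
have : `|re z| < modulus z.
  rewrite modulusE -(sqrtr_sqr (re z)) ltr_sqrt ?sqrD_gt0 ?h ?orbT//.
  by rewrite ltrDl exprn_even_gt0.
by rewrite ltr_norml -subr_gt0 => /andP[]; rewrite opprK addrC.
Qed.

Lemma modulus_sqr z : modulus z ^+ 2 = re z ^+ 2 + im z ^+ 2.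
Proof. by rewrite modulusE sqr_sqrtr// addr_ge0 ?sqr_ge0. Qed.

(** The half-angle formula replaces [acos], which is not differentiable at the value 1 taken on the
    positive real axis and comes with a case distinction on the sign of [im z], by [atan], which is
    smooth everywhere. *)
Lemma Carg_atan z : slit z -> Carg z = 2 * atan (im z / (modulus z + re z)).
Proof.
move=> sz; have h := slit_add_gt0 sz.
have m0 := modulus_gt0 (slit_neq0 sz).
have e := modulus_sqr z.
rewrite /Carg; set a := re z in h e *; set b := im z in e *.
set m := modulus z in m0 h e *.
set u := atan _; have [u1 u2] : - (pi / 2) < u /\ u < pi / 2.
  by split; [exact: atan_gtNpi2|exact: atan_ltpi2].
(* Double-angle formula; the sign of [u] is that of [im z], which selects the branch in [Carg]. *)
have cosu : cos (2 * u) = a / m.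
  rewrite mulr_natl cos_mulr2n cos_atan exprVn sqr_sqrtr; last first.
    by rewrite addr_ge0 ?ler01 ?sqr_ge0.
  have -> : 1 + (b / (m + a)) ^+ 2 = 2 * m / (m + a).
    have -> : (b / (m + a)) ^+ 2 = (m ^+ 2 - a ^+ 2) / (m + a) ^+ 2.
      by rewrite e; field; rewrite lt0r_neq0.
    by field; rewrite lt0r_neq0.
  by rewrite mulr2n; field; rewrite !lt0r_neq0.
rewrite -cosu; case: ifPn => [b0|].
  apply: cosK; rewrite in_itv /=; apply/andP; split; last by lra.
  by rewrite mulr_ge0// -(atan0 R) le_atan// divr_ge0// ltW.
rewrite -ltNge => b0; rewrite cosKN ?opprK//; apply/andP; split; first by lra.
rewrite -(opprK u) mulrN oppr_le0 mulr_ge0// -atanN -(atan0 R) le_atan//.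
by rewrite -mulNr; apply: divr_ge0; rewrite ?oppr_ge0 ltW.
Qed.

Lemma near_slit (g : R -> C R) t dg : is_cderive g t dg -> slit (g t) ->
  \forall s \near t, slit (g s).
Proof.
move=> [/is_derive_cvg g1 /is_derive_cvg g2] /orP[h|h].
- by near=> s; apply/orP; left; near: s; exact: (cvgr_gt _ g1).
- by near=> s; apply/orP; right; near: s; exact: (cvgr_neq0 _ g2).
Unshelve. all: by end_near. Qed.

Lemma is_derive_modulus (g : R -> C R) t dg : g t != 0 ->
  is_cderive g t dg -> is_derive t 1 (fun s => modulus (g s))
    ((re (g t) * re dg + im (g t) * im dg) / modulus (g t)).
Proof.
move=> g0 [g1 g2].
have n0 := normsq_gt0 g0.
have m0 := modulus_gt0 g0.
rewrite modulusE in m0 *.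
under eq_fun do rewrite modulusE.
have dn := is_derive_fD (is_derive_fX2 g1) (is_derive_fX2 g2).
apply: (is_derive_eq (is_derive_fcomp dn (is_derive1_sqrt n0))).
by field; rewrite lt0r_neq0.
Qed.

Lemma is_derive_Carg (g : R -> C R) t dg : slit (g t) ->
  is_cderive g t dg ->
  is_derive t 1 (fun s => Carg (g s)) (im (dg / g t)).
Proof.
move=> sg dg1; have [g1 g2] := dg1.
have h := slit_add_gt0 sg.
have g0 := slit_neq0 sg.
have m0 := modulus_gt0 g0.
have e := modulus_sqr (g t).
apply: (@is_derive_near_eq _
    (fun s => 2 * atan (im (g s) / (modulus (g s) + re (g s))))).
  by near=> s; rewrite Carg_atan//; near: s; exact: near_slit dg1 _.
have dm := is_derive_modulus g0 dg1.
have dq := is_derive_fM g2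
  (@is_derive_fV _ (fun s => modulus (g s) + re (g s)) _ _ (lt0r_neq0 h)
     (is_derive_fD dm g1)).
have := is_derive_fM (is_derive_fcst 2 t)
  (is_derive_fcomp dq (is_derive1_atan _)).
move=> /is_derive_eq; apply; rewrite mulr0 addr0 !cE -e.
move: h m0 e; set m := modulus (g t); set a := re (g t); set b := im (g t).
move=> h m0 e.
have -> : 1 + (b / (m + a)) ^+ 2 = 2 * m / (m + a).
  have -> : (b / (m + a)) ^+ 2 = (m ^+ 2 - a ^+ 2) / (m + a) ^+ 2.
    by rewrite e; field; rewrite lt0r_neq0.
  by field; rewrite lt0r_neq0.
apply/eqP; rewrite -subr_eq0.
apply/eqP; set da := re dg; set db := im dg.
clearbody m a b da db; clear -m0 h e.
(* The difference of the two sides is a multiple of m^2 - (a^2 + b^2), which is zero by [e]. *)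
transitivity ((m ^+ 2 - (a ^+ 2 + b ^+ 2)) * db / (m ^+ 2 * (m + a))); last first.
  by rewrite e subrr !mul0r.
rewrite invf_div; field.
by rewrite !lt0r_neq0.
Unshelve. all: by end_near. Qed.

Lemma is_cderive_Clog (g : R -> C R) t dg : slit (g t) ->
  is_cderive g t dg -> is_cderive (fun s => Clog (g s)) t (dg / g t).
Proof.
move=> sg dg1; split; last exact: is_derive_Carg.
exact: is_derive_lnmod (slit_neq0 sg) dg1.
Qed.

Lemma Carg_ge0 (a : R) : 0 < a -> Carg (rc a) = 0.
Proof.
move=> a0; rewrite Carg_atan; last by rewrite /slit /= a0.
by rewrite /= mul0r atan0 mulr0.
Qed.

Lemma Carg_lt0 (a : R) : a < 0 -> Carg (rc a) = pi.
Proof.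
move=> a0; rewrite /Carg /= lexx expr0n /= addr0 sqrtr_sqr ltr0_norm//.
by rewrite invrN mulrN divff ?acosN1// lt_eqF.
Qed.

Lemma Carg_conj z : im z != 0 -> Carg (conjc z) = - Carg z.
Proof.
case: z => a b /= b0; rewrite !Carg_atan /slit /= ?oppr_eq0 ?b0 ?orbT//.
by rewrite sqrrN mulNr atanN mulrN.
Qed.

End ComplexLog.

(** * Derivative of the Bloch-Wigner function *)

Section BlochWignerIntegral.
Variable R : realType.
Implicit Types (x y z : C R) (t s : R).
Notation mu := (@lebesgue_measure R).

Lemma continuous_itv_integrable (f : R -> R) (a b : R) :
  (forall s, a <= s <= b -> {for s, continuous f}) ->
  mu.-integrable `[a, b] (EFin \o f).
Proof.
move=> cf; apply: continuous_compact_integrable; first exact: segment_compact.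
by apply: continuous_in_subspaceT => s /set_mem /=; rewrite in_itv /= => /cf.
Qed.

Lemma Rintegral_FTC2 (f F : R -> R) (a b : R) : a < b ->
  (forall s, a <= s <= b -> {for s, continuous f}) ->
  (forall s, a <= s <= b -> is_derive s 1 F (f s)) ->
  \int[mu]_(s in `[a, b]) f s = F b - F a.
Proof.
move=> ab cf dF; rewrite /Rintegral (@continuous_FTC2 _ f F)//.
- by apply: continuous_in_subspaceT => s /set_mem /=; rewrite in_itv /= => /cf.
- split.
  + move=> s; rewrite in_itv /= => /andP[h1 h2].
    have h : a <= s <= b by rewrite !ltW.
    exact: (@ex_derive _ _ _ _ _ _ _ (dF s h)).
  + apply: cvg_at_right_filter; apply: is_derive_cvg (dF a _).
    by rewrite lexx ltW.
  + apply: cvg_at_left_filter; apply: is_derive_cvg (dF b _).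
    by rewrite lexx ltW.
- move=> s; rewrite in_itv /= => /andP[h1 h2].
  have h : a <= s <= b by rewrite !ltW.
  by rewrite derive1E; exact: (@derive_val _ _ _ _ _ _ _ (dF s h)).
Qed.

(* The integrand of the imaginary part in [BlochWigner], extended by
   continuity at [s = 0]. *)
Definition BW_kernel x s : R :=
  if s == 0 then - im x else Carg (1 - rc s * x) / s.

Lemma is_cderive_ray x s : is_cderive (fun s => 1 - rc s * x) s (- x).
Proof.
rewrite (_ : (fun s => _) = (fun s => 1 + rc s * (- x))).
  exact: is_cderive_affine.
by apply/funext => u; rewrite mulrN.
Qed.

Lemma rc0 : rc 0 = 0 :> C R. Proof. by []. Qed.
Lemma rc1 : rc 1 = 1 :> C R. Proof. by []. Qed.

Definition cut_free x := (im x != 0) || (re x < 1).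

Lemma slit_ray x s : cut_free x -> 0 <= s <= 1 -> slit (1 - rc s * x).
Proof.
rewrite /cut_free /slit !cE /= !mul0r !addr0 => cx /andP[s0 s1].
have [->|sn0] := eqVneq s 0; first by rewrite !mul0r !subr0 ltr01.
case/orP: cx => [b0|a1].
  by apply/orP; right; rewrite add0r oppr_eq0 mulf_neq0.
apply/orP; left; rewrite oppr0 addr0 subr_gt0.
have [a0|a0] := lerP (re x) 0.
  by rewrite (le_lt_trans _ ltr01)// mulr_ge0_le0.
by rewrite (le_lt_trans _ a1)// ler_piMl// ltW.
Qed.

(** Away from 0 this is a quotient of differentiable functions. At 0 the kernel is the difference
    quotient of s |-> Carg (1 - s x), whose limit is the derivative - im x. *)
Lemma BW_kernel_continuous x s : cut_free x -> 0 <= s <= 1 ->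
  {for s, continuous (BW_kernel x)}.
Proof.
move=> cx hs; have ds := is_derive_Carg (slit_ray cx hs) (is_cderive_ray x s).
have [s0|s0] := eqVneq s 0.
  rewrite s0 in ds *; apply/continuous_withinNx.
  have [d0 v0] := ds.
  move/cvg_ex: d0 => [l dl].
  have el : l = - im x.
    rewrite -(cvg_lim (@Rhausdorff R) dl) -[LHS]/(derive _ _ _) v0.
    by rewrite rc0 mul0r subr0 divr1 imN.
  rewrite el in dl.
  rewrite {2}/BW_kernel eqxx.
  move: dl; apply: cvg_trans; apply: near_eq_cvg.
  near=> h.
  have h0 : h != 0 by near: h; exact: nbhs_dnbhs_neq.
  rewrite /BW_kernel (negbTE h0) /= addr0 rc0 mul0r subr0.
  by rewrite [X in _ - X](Carg_ge0 ltr01) subr0 /GRing.scale /= mulr1 mulrC.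
apply: (@is_derive_cvg _ _ _ (Carg (1 - rc s * x) * (- 1 / s ^+ 2)
  + s^-1 * im (- x / (1 - rc s * x)))).
apply: (@is_derive_near_eq _ (fun s => Carg (1 - rc s * x) / s)).
  near=> u; rewrite /BW_kernel ifN//; near: u.
  by apply: (cvgr_neq0 s) => //; exact: cvg_id.
apply: is_derive_fM ds _.
by apply: (@is_derive_fV _ id) => //; exact: is_derive_id.
Unshelve. all: by end_near. Qed.

Lemma im_div_rc z s : s != 0 -> im (z / rc s) = im z / s.
Proof. by move=> s0; rewrite !cE /=; field. Qed.

(** For real s the factor x cancels and only the argument of 1 - s x contributes to the imaginary
    part. The integrand is therefore [BW_kernel] except at s = 0, where division by zero makes it 0;
    dropping that endpoint changes neither integral. *)
Lemma BlochWignerE x : mu.-integrable `[0, 1] (EFin \o BW_kernel x) ->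
  x != 0 ->
  BlochWigner x = Carg (1 - x) * ln (modulus x)
                  - \int[mu]_(s in `[0, 1]) BW_kernel x s.
Proof.
move=> ik x0; congr (_ - _); rewrite /segment_integral /=.
have ik' : mu.-integrable `]0, 1] (EFin \o BW_kernel x).
  by apply: integrableS ik => //; apply: subset_itvr; rewrite bnd_simp.
have e s : `]0, 1] s -> im (Clog (1 - Complex s 0 * x) / (Complex s 0 * x) * x)
    = BW_kernel x s.
  rewrite /= in_itv /= => /andP[s0 _].
  have rs0 : rc s != 0 :> C R by rewrite eq_complex /= eqxx andbT gt_eqF.
  rewrite /BW_kernel gt_eqF// invfM mulrA mulfVK//.
  by rewrite -[Complex s 0]/(rc s) im_div_rc ?gt_eqF.
rewrite -!Rintegral_itv_obnd_cbnd//.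
  by apply: eq_Rintegral => s /set_mem /e.
apply: eq_integrable ik' => //= s /set_mem /e /= ->.
by [].
Qed.

(** An antiderivative is im ((w / x) Log (1 - s x)). With w the derivative of a path at its point x,
    the integrand is the derivative of [BW_kernel] along the path. *)
Lemma Rintegral_ray x (w : C R) : cut_free x -> x != 0 ->
  \int[mu]_(s in `[0, 1]) - im (w / (1 - rc s * x)) = im (w / x * Clog (1 - x)).
Proof.
move=> cx x0.
have dL s : 0 <= s <= 1 ->
    is_derive s 1 (fun s => im (w / x * Clog (1 - rc s * x)))
      (- im (w / (1 - rc s * x))).
  move=> hs; have ss := slit_ray cx hs.
  have [_] := is_cderiveM (is_cderive_cst (w / x) s)
    (is_cderive_Clog ss (is_cderive_ray x s)).
  move=> /is_derive_eq; apply; rewrite mul0r addr0 -imN; congr im.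
  by rewrite mulNr mulrN mulrA mulfVK.
rewrite (Rintegral_FTC2 ltr01 _ dL).
  rewrite rc0 rc1 mul1r mul0r subr0 [X in _ - X](_ : _ = 0) ?subr0//.
  rewrite (_ : Clog 1 = 0) ?mulr0//.
  rewrite /Clog -[1]/(rc 1) (Carg_ge0 ltr01) /modulus /= expr1n expr0n /= addr0.
  by rewrite sqrtr1 ln1.
move=> s hs; have ss := slit_neq0 (slit_ray cx hs).
have [_] := is_cderiveN (is_cderiveM (is_cderive_cst w s)
  (is_cderiveV ss (is_cderive_ray x s))).
by under eq_fun do rewrite imN; exact: is_derive_cvg.
Qed.

End BlochWignerIntegral.

Section BlochWignerDerivative.
Variable R : realType.
Implicit Types (x y z : C R) (t s : R).
Notation mu := (@lebesgue_measure R).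

Definition normsq x : R := re x ^+ 2 + im x ^+ 2.

Lemma normsqM x y : normsq (x * y) = normsq x * normsq y.
Proof. by rewrite /normsq !cE; ring. Qed.

Lemma normsq_ge0 x : 0 <= normsq x.
Proof. by rewrite addr_ge0 ?sqr_ge0. Qed.

Lemma normsqV x : normsq x^-1 = (normsq x)^-1.
Proof.
have [->|x0] := eqVneq x 0; first by rewrite invr0 /normsq /= expr0n addr0 invr0.
rewrite /normsq !cE; have := lt0r_neq0 (normsq_gt0 x0).
by move: (re x) (im x) => a b h; field.
Qed.

Lemma is_derive_normsq (g : R -> C R) t dg : is_cderive g t dg ->
  is_derive t 1 (fun s => normsq (g s)) (2 * re (g t) * re dg + 2 * im (g t) * im dg).
Proof. by move=> [g1 g2]; exact: is_derive_fD (is_derive_fX2 g1) (is_derive_fX2 g2). Qed.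

Lemma near_neq0 (g : R -> C R) t dg : is_cderive g t dg -> g t != 0 ->
  \forall u \near t, g u != 0.
Proof.
move=> dgt g0; have cn := is_derive_cvg (is_derive_normsq dgt).
near=> u; have : normsq (g u) != 0.
  by near: u; apply: (cvgr_neq0 _ cn); exact: lt0r_neq0 (normsq_gt0 g0).
by apply: contra => /eqP ->; rewrite /normsq /= expr0n addr0.
Unshelve. all: by end_near. Qed.

(** The bound [c], uniform in [s] and in nearby [u], serves to dominate the differentiated kernel
    under the integral sign. For x = g t with im x != 0, the distance from 1 to the line R x is |im
    x| / |x|; if re x < 1, the real part of 1 - s x is at least min (1, 1 - re x). *)
Lemma near_cut_free (g : R -> C R) t dg : is_cderive g t dg -> cut_free (g t) ->
  exists2 c, 0 < c & \forall u \near t, cut_free (g u) /\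
    forall s, 0 <= s <= 1 -> c <= normsq (1 - rc s * g u).
Proof.
move=> dgt; have [g1 g2] := dgt; have [c1 c2] := (is_derive_cvg g1, is_derive_cvg g2).
have c3 := is_derive_cvg (is_derive_normsq dgt).
have c4 := is_derive_cvg (is_derive_fX2 g2).
case/orP => [b0|a1].
- have b2 : 0 < im (g t) ^+ 2 by rewrite exprn_even_gt0.
  pose n := normsq (g t) + 1.
  have n0 : 0 < n by rewrite ltr_wpDl ?normsq_ge0.
  exists (im (g t) ^+ 2 / 2 / n); first by rewrite !divr_gt0.
  near=> u.
  have bu : im (g t) ^+ 2 / 2 < im (g u) ^+ 2.
    by near: u; apply: (cvgr_gt _ c4); lra.
  have nu : normsq (g u) < n.
    by near: u; apply: (cvgr_lt _ c3); rewrite /n; lra.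
  have bu0 : im (g u) != 0 by near: u; exact: (cvgr_neq0 _ c2).
  split; first by rewrite /cut_free bu0.
  move=> s _.
  have gu0 : 0 < normsq (g u) by rewrite /normsq sqrD_gt0 bu0 orbT.
  have h : im (g u) ^+ 2 <= normsq (1 - rc s * g u) * normsq (g u).
    rewrite /normsq !cE /= -subr_ge0.
    set a := re _; set b := im _.
    (* The distance from 1 to a line through 0: |1 - s x|^2 |x|^2 - (im x)^2 = (re x - s
       |x|^2)^2. *)
    rewrite (_ : _ - _ = (a - s * (a ^+ 2 + b ^+ 2)) ^+ 2) ?sqr_ge0//.
    by ring.
  rewrite ler_pdivrMr//; apply: le_trans (ltW bu) (le_trans h _).
  by rewrite ler_wpM2l ?normsq_ge0// ltW.
- pose m := (1 + re (g t)) / 2.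
  have m1 : m < 1 by rewrite /m; lra.
  exists ((Num.min 1 (1 - m)) ^+ 2).
    by rewrite exprn_gt0// lt_min ltr01 subr_gt0.
  near=> u.
  have um : re (g u) < m by near: u; apply: (cvgr_lt _ c1); rewrite /m; lra.
  split; first by rewrite /cut_free (lt_trans um m1) orbT.
  move=> s /andP[s0 s1]; rewrite /normsq ler_wpDr ?sqr_ge0//.
  rewrite !cE /= mul0r subr0.
  have h0 : 0 <= Num.min 1 (1 - m) by rewrite le_min ler01 subr_ge0 ltW.
  have h : Num.min 1 (1 - m) <= 1 - s * re (g u).
    have [a0|a0] := lerP (re (g u)) 0.
      rewrite ge_min; apply/orP; left.
      by rewrite lerBrDl gerDr mulr_ge0_le0.
    rewrite ge_min; apply/orP; right; rewrite lerB//.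
    by apply: le_trans (ltW um); rewrite ler_piMl// ltW.
  by rewrite ler_pXn2r// nnegrE// (le_trans h0 h).
Unshelve. all: by end_near. Qed.

Lemma ler_im_normsq x : `|im x| <= 1 + normsq x.
Proof.
have h1 : 0 <= (1 - `|im x|) ^+ 2 by rewrite sqr_ge0.
rewrite /normsq -(real_normK (num_real (im x))).
have h2 := sqr_ge0 (re x); have h3 := sqr_ge0 (`|im x|); nra.
Qed.

(** The chain rule yields a factor s which cancels the 1 / s of the kernel, so that one formula
    covers s = 0 as well. *)
Lemma is_derive_BW_kernel (g : R -> C R) t dg s : cut_free (g t) -> 0 <= s <= 1 ->
  is_cderive g t dg ->
  is_derive t 1 (fun u => BW_kernel (g u) s) (- im (dg / (1 - rc s * g t))).
Proof.
move=> cg hs dgt; rewrite /BW_kernel.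
have [s0|s0] := eqVneq s 0.
  by rewrite s0 rc0 mul0r subr0 divr1; case: dgt => _; exact: is_derive_fN.
have dh : is_cderive (fun u => 1 - rc s * g u) t (- (rc s * dg)).
  apply: (is_cderive_eq (is_cderiveD (is_cderive_cst 1 t)
    (is_cderiveN (is_cderiveM (is_cderive_cst (rc s) t) dgt)))).
  by rewrite mul0r addr0 add0r.
have := is_derive_fM (is_derive_Carg (slit_ray cg hs) dh) (is_derive_fcst s^-1 t).
move=> /is_derive_eq; apply; rewrite mulr0 add0r.
rewrite mulNr imN -mulrA (mulrC (rc s)) mulrN.
rewrite [in LHS]imM /= mulr0 add0r.
by rewrite mulrCA mulVf ?mulr1.
Qed.

(** The integral contributes im (g' / g * Log (1 - g)) = re (g' / g) Carg (1 - g) + im (g' / g) ln|1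
    - g|. The first term cancels Carg (1 - g) times the derivative of ln|g|, so that no argument
    survives in the result. *)
Lemma is_derive_BW_cut_free (g dg : R -> C R) t :
  cut_free (g t) -> g t != 0 ->
  (\forall u \near t, is_cderive g u (dg u)) ->
  {for t, continuous (fun u => normsq (dg u))} ->
  is_derive t 1 (fun u => BlochWigner (g u))
    (- ln (modulus (g t)) * im (dg t / (1 - g t))
     - ln (modulus (1 - g t)) * im (dg t / g t)).
Proof.
move=> cg g0 ndg cdg.
have dgt : is_cderive g t (dg t) := nbhs_singleton ndg.
have [c c0 nc] := near_cut_free dgt cg.
have ng0 := near_neq0 dgt g0.
pose K := normsq (dg t) + 1.
have nK : \forall u \near t, normsq (dg u) < K.
  by apply: (cvgr_lt _ cdg); rewrite /K; lra.
pose I u := [/\ is_cderive g u (dg u), g u != 0, normsq (dg u) < K, cut_free (g u) &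
  forall s, 0 <= s <= 1 -> c <= normsq (1 - rc s * g u)].
have [e /= e0 nI] : nbhs_ball t I.
  apply/nbhs_ballP; near=> u.
  have [? ?] : cut_free (g u) /\
    forall s, 0 <= s <= 1 -> c <= normsq (1 - rc s * g u) by near: u.
  by split=> //; near: u.
pose B : set R := `](t - e), (t + e)[.
have II u : B u -> I u.
  rewrite /B /= in_itv /= => /andP[h1 h2]; apply: nI.
  by rewrite /ball /= distrC ltr_norml; apply/andP; split; lra.
have tI : B t by rewrite /B /= in_itv /=; apply/andP; split; lra.
have ik u : cut_free (g u) -> mu.-integrable `[0, 1] (EFin \o BW_kernel (g u)).
  by move=> cu; apply: continuous_itv_integrable => s; exact: BW_kernel_continuous.
have K0 : 0 <= K by rewrite addr_ge0 ?normsq_ge0.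
have d1 u s : B u -> `[0, 1] s ->
    is_derive u 1 (fun u => BW_kernel (g u) s) (- im (dg u / (1 - rc s * g u))).
  move=> /II[? _ _ ? _]; rewrite /= in_itv /= => hs.
  exact: is_derive_BW_kernel.
have p1 u s : B u -> `[0, 1] s ->
    partial1of2 (fun u s => BW_kernel (g u) s) u s = - im (dg u / (1 - rc s * g u)).
  by move=> hu hs; rewrite partial1of2E; have := d1 u s hu hs => -[].
have Iu u : B u ->
    mu.-integrable `[0, 1] (EFin \o BW_kernel (g u)).
  by move=> /II[_ _ _ cu _]; exact: ik.
have dk u s : B u -> `[0, 1] s ->
    derivable (fun u => BW_kernel (g u) s) u 1.
  by move=> hu hs; have [] := d1 u s hu hs.
(* From |im w| <= 1 + |w|^2 for w = g' / (1 - s g), where |g'|^2 < K and |1 - s g|^2 >= c. *)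
pose G (s : R) : R := 1 + K / c.
have G0 s : 0 <= G s by rewrite addr_ge0// divr_ge0// ltW.
have iG : mu.-integrable `[0, 1] (EFin \o G).
  by apply: continuous_itv_integrable => s _; exact: cvg_cst.
have Gub u s : B u -> `[0, 1] s ->
    `|partial1of2 (fun u s => BW_kernel (g u) s) u s| <= G s.
  move=> hu hs; rewrite p1// normrN (le_trans (ler_im_normsq _))// lerD2l.
  have [_ _ hK _] := II _ hu; move: hs; rewrite /= in_itv /= => hs /(_ s hs) hc.
  have n0 := lt_le_trans c0 hc.
  rewrite normsqM normsqV; apply: ler_pM; rewrite ?invr_ge0 ?normsq_ge0//.
    exact: ltW.
  by rewrite lef_pV2 ?posrE.
have mB : measurable (`[0, 1] : set R) by [].
have dF := @derivable_under_integral _ _ _ mu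
  (fun u s => BW_kernel (g u) s) _ mB t (t - e) (t + e) tI Iu dk G G0 iG Gub.
have vF := @differentiation_under_integral _ _ _ mu
  (fun u s => BW_kernel (g u) s) _ mB t (t - e) (t + e) tI Iu dk G G0 iG Gub.
have DF : is_derive t 1 (fun u => \int[mu]_(s in `[0, 1]) BW_kernel (g u) s)
    (im (dg t / g t * Clog (1 - g t))).
  apply: (is_derive_eq (derivableP dF)); rewrite -derive1E vF.
  rewrite -Rintegral_ray//; apply: eq_Rintegral => s /set_mem hs.
  exact: p1.
have dh : is_cderive (fun u => 1 - g u) t (- dg t).
  apply: (is_cderive_eq (is_cderiveD (is_cderive_cst 1 t) (is_cderiveN dgt))).
  by rewrite add0r.
have s1 : slit (1 - g t).
  by rewrite -[g t]mul1r -rc1 slit_ray// ler01 lexx.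
apply: (@is_derive_near_eq _ (fun u => Carg (1 - g u) * ln (modulus (g u))
   + - \int[mu]_(s in `[0, 1]) BW_kernel (g u) s)).
  near=> u; have [_ gu0 _ cu _] : I u.
    by near: u; apply/nbhs_ballP; exists e.
  by rewrite (BlochWignerE (ik u cu) gu0).
apply: (is_derive_eq (is_derive_fD (is_derive_fM (is_derive_Carg s1 dh)
  (is_derive_lnmod g0 dgt)) (is_derive_fN DF))).
rewrite mulNr imN imM /=; ring.
Unshelve. all: by end_near. Qed.

End BlochWignerDerivative.

(** * Values at real points and complex conjugation *)

Section BlochWignerSymmetries.
Variable R : realType.
Implicit Types (x y z : C R) (t s : R).
Notation mu := (@lebesgue_measure R).

Lemma real_rc x : im x = 0 -> x = rc (re x).
Proof. by case: x => a b /= ->. Qed.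

Lemma rcD (a b : R) : rc (a + b) = rc a + rc b :> C R.
Proof. by apply: re_eq_im_eq; rewrite !cE //= addr0. Qed.
Lemma rcN (a : R) : rc (- a) = - rc a :> C R.
Proof. by apply: re_eq_im_eq; rewrite !cE //= oppr0. Qed.
Lemma rcM (a b : R) : rc (a * b) = rc a * rc b :> C R.
Proof. by apply: re_eq_im_eq; rewrite !cE /=; ring. Qed.
Lemma rcV (a : R) : rc a^-1 = (rc a)^-1 :> C R.
Proof.
have [->|a0] := eqVneq a 0; first by rewrite !invr0.
by apply: re_eq_im_eq; rewrite !cE /=; [field|rewrite mul0r oppr0].
Qed.

Lemma BlochWigner_unfold x : BlochWigner x = Carg (1 - x) * ln (modulus x)
  - \int[mu]_(s in `[0, 1]) im (Clog (1 - rc s * x) / (rc s * x) * x).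
Proof. by []. Qed.

Lemma Clog_rc_gt0 (a : R) : 0 < a -> Clog (rc a) = rc (ln a).
Proof. by move=> a0; rewrite /Clog Carg_ge0// modulusE /= expr0n addr0 sqrtr_sqr gtr0_norm. Qed.

Lemma modulus_rc (a : R) : modulus (rc a) = `|a|.
Proof. by rewrite modulusE /= expr0n /= addr0 sqrtr_sqr. Qed.

Lemma BlochWigner_real_lt1 (a : R) : a < 1 -> BlochWigner (rc a) = 0.
Proof.
move=> a1; rewrite BlochWigner_unfold.
rewrite -rc1 -rcN -rcD Carg_ge0 ?subr_gt0// mul0r add0r.
rewrite (@eq_Rintegral _ _ _ mu _ (cst 0)) ?Rintegral_cst// ?mul0r ?oppr0//.
move=> s /set_mem hs; have /andP[s0 s1] : 0 <= s <= 1.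
  by move: hs; rewrite /= in_itv.
rewrite /cst -!rcM -rcN -rcD Clog_rc_gt0; first by rewrite -rcV -!rcM.
rewrite subr_gt0; have [a0|a0] := lerP a 0.
  by rewrite (le_lt_trans _ ltr01)// mulr_ge0_le0.
by rewrite (le_lt_trans _ a1)// ler_piMl// ltW.
Qed.

(** Here 1 - s a changes sign at s = 1 / a: the integrand is 0 before and pi / s after, and its
    integral pi ln a cancels the first term. *)
Lemma BlochWigner_real_gt1 (a : R) : 1 < a -> BlochWigner (rc a) = 0.
Proof.
move=> a1; have a0 : 0 < a := lt_trans ltr01 a1.
have a0' := lt0r_neq0 a0.
rewrite BlochWigner_unfold.
rewrite -rc1 -rcN -rcD Carg_lt0 ?subr_lt0// modulus_rc gtr0_norm//.
apply/eqP; rewrite subr_eq0; apply/eqP; symmetry.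
pose c := a^-1; have c0 : 0 < c by rewrite invr_gt0.
have c1 : c < 1 by rewrite invf_lt1.
(* At the jump s = c the logarithm is taken at 0; its default value is kept in [f], so that the
   integrands agree at every nonzero s of the interval. The power with exponent -1 is 1 / s for s >
   0 and is measurable on the whole line. *)
pose f s : R := if s < c then 0 else if s == c then Carg (0 : C R) / c else pi * s `^ (-1).
have fV s : 0 < s -> s `^ (-1) = s^-1 by move=> s0; rewrite powR_inv1 ?ltW.
have fE s : im (Clog (rc 1 - rc s * rc a) / (rc s * rc a) * rc a) = 
    if s == 0 then 0 else f s.
  have [->|s0] := eqVneq s 0.
    by rewrite rc0 mul0r invr0 mulr0 mul0r.
  rewrite -!rcM -rcN -rcD -rcV -mulrA -rcM invfM mulfVK// rcV im_div_rc//.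
  rewrite /f; have [sc|sc|->] := ltgtP s c.
  - rewrite -[im _]/(Carg _) Carg_ge0 ?mul0r// subr_gt0 -ltr_pdivlMr// div1r.
    exact: sc.
  - rewrite -[im _]/(Carg _) Carg_lt0 ?fV// ?(lt_trans c0)// subr_lt0 -ltr_pdivrMr// div1r.
    exact: sc.
  - by rewrite /c mulVf// subrr.
under eq_Rintegral do rewrite fE.
have eqf s : `]0, 1] s -> (if s == 0 then 0 else f s) = f s.
  by rewrite /= in_itv /= => /andP[s0 _]; rewrite gt_eqF.
have intf : mu.-integrable `[0, 1] (EFin \o f).
  apply: measurable_bounded_integrable => //.
  - by rewrite /= lebesgue_measure_itv /= lte01 -EFinD ltry.
  - apply: (@measurable_funS _ _ _ _ setT) => //.
    apply: measurable_fun_ifT => //.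
      by apply: measurable_fun_ltr => //; exact: measurable_id.
    apply: measurable_fun_ifT => //.
      by apply: measurable_fun_eqr => //; exact: measurable_id.
    by apply: measurable_funM => //; exact: measurable_powR.
  - exists (`|Carg (0 : C R) / c| + pi / c); split; rewrite ?num_real// => M hM s _.
    rewrite /= (le_trans _ (ltW hM))// /f.
    have pc : 0 <= pi / c :> R by rewrite divr_ge0 ?pi_ge0// ltW.
    case: ltgtP => [_|sc|_]; rewrite ?normr0 ?addr_ge0//; last by rewrite lerDl.
    rewrite fV ?(lt_trans c0 sc)//.
    rewrite ler_wpDl// ger0_norm ?divr_ge0 ?pi_ge0 ?(ltW (lt_trans c0 sc))//.
    by rewrite ler_wpM2l ?pi_ge0// lef_pV2 ?posrE ?(lt_trans c0 sc)// ltW.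
have intf' : mu.-integrable `]0, 1] (EFin \o f).
  by apply: integrableS intf => //; apply: subset_itvr; rewrite bnd_simp.
transitivity (\int[mu]_(s in `[0, 1]) f s).
  rewrite -!Rintegral_itv_obnd_cbnd//.
    by apply: eq_Rintegral => s /set_mem /eqf.
  by apply: eq_integrable intf' => //= s /set_mem /eqf /= ->.
have := Rintegral_itvB intf; move=> /(_ c); rewrite !bnd_simp !ltW// => /(_ isT isT).
have -> : \int[mu]_(s in `[0, c]) f s = 0.
  rewrite -Rintegral_itv_bndo_bndc.
    rewrite (@eq_Rintegral _ _ _ mu _ (cst 0)) ?Rintegral_cst// ?mul0r//.
    by move=> s /set_mem; rewrite /= in_itv /= => /andP[_ sc]; rewrite /f sc.
  by apply: integrableS intf => //; apply: subset_itvl; rewrite bnd_simp ltW.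
rewrite subr0 => ->.
have hp : \int[mu]_(s in `[c, 1]) (pi / s) = pi * ln a.
  transitivity (pi * ln 1 - pi * ln c); last first.
    by rewrite ln1 mulr0 sub0r -mulrN -lnV ?posrE// /c invrK.
  apply: (@Rintegral_FTC2 _ _ (fun s => pi * ln s)) => //.
  - move=> s /andP[cs _]; have s0 := lt_le_trans c0 cs.
    have := is_derive_fM (is_derive_fcst pi s)
      (@is_derive_fV _ id s 1 (lt0r_neq0 s0) (is_derive_id _ _)).
    exact: is_derive_cvg.
  - move=> s /andP[cs _]; have s0 := lt_le_trans c0 cs.
    have := is_derive_fM (is_derive_fcst pi s) (is_derive1_ln s0).
    by move=> /is_derive_eq; apply; rewrite mulr0 addr0.
rewrite -hp -Rintegral_itv_obnd_cbnd.
  apply: eq_Rintegral => s /set_mem; rewrite /= in_itv /= => /andP[cs _].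
  by rewrite /f ltNge (ltW cs) /= gt_eqF// fV// (lt_trans c0 cs).
apply: (@integrableS _ _ _ mu `[c, 1]) => //.
  by apply: subset_itvr; rewrite bnd_simp.
apply: continuous_itv_integrable => s /andP[cs _]; have s0 := lt_le_trans c0 cs.
have := is_derive_fM (is_derive_fcst pi s)
  (@is_derive_fV _ id s 1 (lt0r_neq0 s0) (is_derive_id _ _)).
exact: is_derive_cvg.
Qed.

Lemma BlochWigner_real x : im x = 0 -> x != 1 -> BlochWigner x = 0.
Proof.
move=> /real_rc ->; move: (re x) => a; rewrite -rc1 => a1.
have [?|?|e] := ltgtP a 1; first exact: BlochWigner_real_lt1.
  exact: BlochWigner_real_gt1.
by rewrite e eqxx in a1.
Qed.

Lemma BW_kernel_integrable x : cut_free x ->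
  mu.-integrable `[0, 1] (EFin \o BW_kernel x).
Proof. by move=> cx; apply: continuous_itv_integrable => s; exact: BW_kernel_continuous. Qed.

Lemma BlochWigner_conj x : im x != 0 -> BlochWigner (conjc x) = - BlochWigner x.
Proof.
move=> b0.
have cx : cut_free x by rewrite /cut_free b0.
have imc z : im (conjc z) = - im z by case: z.
have cx' : cut_free (conjc x) by rewrite /cut_free imc oppr_eq0 b0.
have x0 : x != 0 by apply: contraNneq b0 => ->.
have x0' : conjc x != 0 by apply: contraNneq b0 => /(congr1 (@im R)) /eqP; rewrite imc oppr_eq0.
have modc z : modulus (conjc z) = modulus z by case: z => a b; rewrite !modulusE /= sqrrN.
rewrite !BlochWignerE ?BW_kernel_integrable// modc.
have cc s : 1 - rc s * conjc x = conjc (1 - rc s * x).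
  by case: x {b0 cx cx' x0 x0'} => a b; apply: re_eq_im_eq; rewrite !cE /=; ring.
have := cc 1; rewrite rc1 !mul1r => ->.
rewrite Carg_conj; last by rewrite !cE add0r oppr_eq0.
rewrite mulNr opprD; congr (_ + _).
congr (- _); rewrite -mulN1r -RintegralZl ?BW_kernel_integrable//.
apply: eq_Rintegral => s /set_mem; rewrite /= in_itv /= => hs.
rewrite mulN1r /BW_kernel; case: eqVneq => [_|s0]; first by rewrite imc.
by rewrite cc Carg_conj ?mulNr// !cE /= mul0r addr0 add0r oppr_eq0 mulf_neq0.
Qed.

End BlochWignerSymmetries.

(** * The five-term relation *)

Section FiveTermDerivative.
Variable R : realType.
Implicit Types (x y z : C R) (t s : R).

(** Continuity at [t] is asked of |dg|^2: this bounds the derivative near [t], as the domination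
    under the integral sign requires, and it passes to inverses and affine images of the path. *)
Definition C1path (g dg : R -> C R) t :=
  (\forall u \near t, is_cderive g u (dg u)) /\
  normsq (dg u) @[u --> t] --> normsq (dg t).

Lemma C1path_line x v t : C1path (fun u => x + rc u * v) (fun=> v) t.
Proof. by split; [near=> u; exact: is_cderive_affine|exact: cvg_cst].
Unshelve. all: by end_near. Qed.

Lemma C1path_inv (g dg : R -> C R) t : C1path g dg t -> g t != 0 ->
  C1path (fun u => (g u)^-1) (fun u => - dg u / g u ^+ 2) t.
Proof.
move=> [ng cg] g0; have dgt : is_cderive g t (dg t) := nbhs_singleton ng.
split.
  have ng0 := near_neq0 dgt g0.
  by near=> u; apply: is_cderiveV; near: u.
have cn := is_derive_cvg (is_derive_normsq dgt).
have n0 := lt0r_neq0 (normsq_gt0 g0).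
have e u : normsq (- dg u / g u ^+ 2) = normsq (dg u) / (normsq (g u) * normsq (g u)).
  by rewrite normsqM normsqV expr2 normsqM /normsq !cE !sqrrN.
rewrite (_ : (fun u => _) = (fun u => normsq (dg u) / (normsq (g u) * normsq (g u)))).
  rewrite e; apply: cvgM; first exact: cg.
  by apply: cvgV; [rewrite mulf_neq0|exact: cvgM].
exact/funext.
Unshelve. all: by end_near. Qed.

Lemma C1path_affine (g dg : R -> C R) a b t : C1path g dg t ->
  C1path (fun u => a + b * g u) (fun u => b * dg u) t.
Proof.
move=> [ng cg]; split.
  near=> u; apply: (is_cderive_eq (is_cderiveD (is_cderive_cst a u)
    (is_cderiveM (is_cderive_cst b u) (_ : is_cderive g u (dg u))))).
    by near: u.
  by rewrite mul0r addr0 add0r.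
rewrite (_ : (fun u => _) = (fun u => normsq b * normsq (dg u))).
  by rewrite normsqM; apply: cvgM => //; exact: cvg_cst.
by apply/funext => u; rewrite normsqM.
Unshelve. all: by end_near. Qed.

Lemma derive0_const (H : R -> R) :
  (forall t, 0 <= t <= 1 -> is_derive t 1 H 0) -> H 0 = H 1.
Proof.
move=> dH; have [|||c _] := @MVT _ H (fun=> 0) 0 1; rewrite ?ltr01//.
- by move=> x; rewrite in_itv /= => /andP[h1 h2]; apply: dH; rewrite !ltW.
- apply: continuous_in_subspaceT => s /set_mem /=; rewrite in_itv /= => hs.
  exact: is_derive_cvg (dH s hs).
- by rewrite mul0r => /eqP; rewrite subr_eq0 => /eqP.
Qed.

Lemma ln_modulusM x y : x != 0 -> y != 0 ->
  ln (modulus (x * y)) = ln (modulus x) + ln (modulus y).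
Proof. by move=> x0 y0; rewrite modulusM lnM// posrE modulus_gt0. Qed.

Lemma ln_modulusV x : x != 0 -> ln (modulus x^-1) = - ln (modulus x).
Proof. by move=> x0; rewrite modulusV lnV// posrE modulus_gt0. Qed.

Lemma ln_modulusN x : ln (modulus (- x)) = ln (modulus x).
Proof. by rewrite !modulusE !cE !sqrrN. Qed.

(** With p and q the logarithmic derivatives of g and 1 - g, this is log|g| d arg (1 - g) - log|1 -
    g| d arg g. Factorizations of g and 1 - g thus become sums, which [ring] can compare. *)
Lemma is_derive_BW_dlog (g dg : R -> C R) t (p q : C R) (l1 l2 : R) :
  is_derive t 1 (fun u => BlochWigner (g u))
    (- ln (modulus (g t)) * im (dg t / (1 - g t))
     - ln (modulus (1 - g t)) * im (dg t / g t)) ->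
  dg t / g t = p -> dg t / (1 - g t) = - q ->
  ln (modulus (g t)) = l1 -> ln (modulus (1 - g t)) = l2 ->
  is_derive t 1 (fun u => BlochWigner (g u)) (l1 * im q - l2 * im p).
Proof.
by move=> dB hp hq h1 h2; apply: (is_derive_eq dB); rewrite hp hq h1 h2 imN mulrNN.
Qed.

Lemma im_neq0_neq x (a : R) : im x != 0 -> x != rc a.
Proof. by apply: contraNneq => ->. Qed.

(** On the segment from x to i neither g nor 1 / g is real, and D(g) + D(1 / g) has derivative zero.
    At the end, 1 / i is the conjugate of i, so the sum vanishes there. *)
Lemma BlochWigner_inv_upper x : 0 < im x -> BlochWigner x^-1 = - BlochWigner x.
Proof.
move=> x0; pose i : C R := Complex 0 1; pose g u := x + rc u * (i - x).
have gpos u : 0 <= u <= 1 -> 0 < im (g u).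
  move=> /andP[u0 u1]; rewrite !cE /= mul0r addr0.
  by rewrite (_ : _ + _ = (1 - u) * im x + u); [nra|ring].
have dH t : 0 <= t <= 1 ->
    is_derive t 1 (fun u => BlochWigner (g u) + BlochWigner (g u)^-1) 0.
  move=> /gpos gt; have gn : im (g t) != 0 by rewrite gt_eqF.
  have g0 : g t != 0 := im_neq0_neq 0 gn.
  have g1 : g t - 1 != 0 by rewrite subr_eq0; exact: (im_neq0_neq 1 gn).
  have g1' : 1 - g t != 0 by rewrite -opprB oppr_eq0.
  have [C1 C1'] := C1path_line x (i - x) t.
  have [C2 C2'] := C1path_inv (conj C1 C1') g0.
  have cg : cut_free (g t) by rewrite /cut_free gn.
  have cg' : cut_free (g t)^-1.
    rewrite /cut_free imV oppr_eq0 mulf_eq0 invr_eq0 negb_or gn /=.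
    by rewrite lt0r_neq0// normsq_gt0.
  have e : 1 - (g t)^-1 = (g t - 1) / g t by field.
  have B1 := is_derive_BW_dlog (is_derive_BW_cut_free cg g0 C1 C1')
     (erefl _) (esym (opprK _)) (erefl _) (erefl _).
  have B2 := @is_derive_BW_dlog _ _ _ (- ((i - x) / g t)) (- ((i - x) / g t + (i - x) / (1 - g t)))
    (- ln (modulus (g t))) (ln (modulus (1 - g t)) - ln (modulus (g t)))
    (is_derive_BW_cut_free cg' (_ : (g t)^-1 != 0) C2 C2').
  apply: (is_derive_eq (is_derive_fD B1 (B2 _ _ _ _ _))).
  - by rewrite invr_eq0.
  - by rewrite -/(g t); field.
  - by rewrite -/(g t); field; rewrite g0 g1 g1'.
  - by rewrite ln_modulusV.
  - by rewrite e ln_modulusM ?invr_eq0// ln_modulusV// -(ln_modulusN (g t - 1)) opprB.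
  - by rewrite !imN !imD; ring.
have g0 : g 0 = x by rewrite /g rc0 mul0r addr0.
have g1 : g 1 = i by rewrite /g rc1 mul1r addrC subrK.
have := derive0_const dH; rewrite g0 g1 => h.
apply/eqP; rewrite -addr_eq0 addrC h; apply/eqP.
have -> : i^-1 = conjc i by apply: re_eq_im_eq; rewrite !cE /= ?mul0r// expr0n expr1n add0r divr1.
by rewrite BlochWigner_conj ?subrr//= oner_neq0.
Qed.

Lemma BlochWigner_inv x : x != 1 -> BlochWigner x^-1 = - BlochWigner x.
Proof.
move=> x1; have [x0|x0|x0] := ltgtP (im x) 0.
- have n0 : im x != 0 by rewrite lt_eqF.
  have xn0 : x != 0 := im_neq0_neq 0 n0.
  have := @BlochWigner_inv_upper (conjc x).
  have -> : im (conjc x) = - im x by case: x {x1 x0 n0 xn0}.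
  rewrite oppr_gt0 => /(_ x0); rewrite -conjc_inv !BlochWigner_conj//; first by move=> /oppr_inj.
  by rewrite imV oppr_eq0 mulf_eq0 invr_eq0 negb_or n0 /= lt0r_neq0// normsq_gt0.
- exact: BlochWigner_inv_upper.
- by rewrite !BlochWigner_real ?oppr0 ?invr_eq1// !cE x0 mul0r oppr0.
Qed.

Lemma is_derive_BW (g dg : R -> C R) t (p q : C R) (l1 l2 : R) :
  C1path g dg t -> g t != 0 -> g t != 1 ->
  dg t / g t = p -> dg t / (1 - g t) = - q ->
  ln (modulus (g t)) = l1 -> ln (modulus (1 - g t)) = l2 ->
  is_derive t 1 (fun u => BlochWigner (g u)) (l1 * im q - l2 * im p).
Proof.
move=> [C1 C1'] g0 g1 hp hq h1 h2.
have [cg|] := boolP (cut_free (g t)).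
  exact: (is_derive_BW_dlog (is_derive_BW_cut_free cg g0 C1 C1')).
rewrite /cut_free negb_or negbK -leNgt => /andP[/eqP b0 a1].
have [C2 C2'] := C1path_inv (conj C1 C1') g0.
have dgt : is_cderive g t (dg t) := nbhs_singleton C1.
have g1' : 1 - g t != 0 by rewrite subr_eq0 eq_sym.
have g1'' : g t - 1 != 0 by rewrite subr_eq0.
have a1' : 1 < re (g t).
  rewrite lt_neqAle a1 andbT; apply: contra g1 => /eqP a.
  by apply/eqP/re_eq_im_eq.
have cg' : cut_free (g t)^-1.
  apply/orP; right; rewrite !cE b0 expr0n addr0 expr2 invfM mulrA mulfV.
    by rewrite mul1r invf_lt1// (lt_trans ltr01).
  by rewrite gt_eqF// (lt_trans ltr01).
have e : 1 - (g t)^-1 = (g t - 1) / g t by field.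
have n1 : \forall u \near t, g u - 1 != 0.
  apply: (@near_neq0 _ (fun u => g u - 1) t (dg t)) => //.
  apply: (is_cderive_eq (is_cderiveD dgt (is_cderive_cst (-1) t))).
  by rewrite addr0.
apply: (@is_derive_near_eq _ (fun u => - BlochWigner (g u)^-1)).
  near=> u; rewrite BlochWigner_inv ?opprK// -subr_eq0.
  by near: u.
have B2 := @is_derive_BW_dlog _ _ _ (- p) (q - p) (- l1) (l2 - l1)
    (is_derive_BW_cut_free cg' (_ : (g t)^-1 != 0) C2 C2').
apply: (is_derive_eq (is_derive_fN (B2 _ _ _ _ _))).
- by rewrite invr_eq0.
- by rewrite -hp; field.
- by rewrite -hp -[q]opprK -hq; field; rewrite g0 g1' g1''.
- by rewrite ln_modulusV// h1.
- by rewrite e ln_modulusM ?invr_eq0// ln_modulusV// -(ln_modulusN (g t - 1)) opprB h1 h2.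
- by rewrite !imN !imD !imN; ring.
Unshelve. all: by end_near. Qed.

Definition BW_five_term x y : R :=
  BlochWigner x - BlochWigner y + BlochWigner (y / x)
  - BlochWigner ((1 - x^-1) / (1 - y^-1)) + BlochWigner ((1 - x) / (1 - y)).

(** Only the first variable moves. The logarithmic derivatives of the arguments and of their
    complements are integral combinations of v / X, v / (X - 1) and v / (X - y), and the logarithms
    of their moduli are combinations of those of X, 1 - X, X - y, y and 1 - y; the alternating
    expressions then add up to zero. *)
Lemma is_derive_BW_five_term x v y t : y != 0 -> y != 1 ->
  x + rc t * v != 0 -> x + rc t * v != 1 -> x + rc t * v != y ->
  is_derive t 1 (fun u => BW_five_term (x + rc u * v) y) 0.
Proof.
move=> y0 y1; set X := x + rc t * v => X0 X1 Xy.
have y1' : y - 1 != 0 by rewrite subr_eq0.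
have y1'' : 1 - y != 0 by rewrite -opprB oppr_eq0.
have X1' : X - 1 != 0 by rewrite subr_eq0.
have X1'' : 1 - X != 0 by rewrite -opprB oppr_eq0.
have Xy' : X - y != 0 by rewrite subr_eq0.
have C1 := C1path_line x v t.
have C2 := C1path_inv C1 X0.
(* The paths y / X, (1 - 1 / X) / (1 - 1 / y) and (1 - X) / (1 - y), as affine functions of 1 / X or
   X. *)
have C3 := C1path_affine 0 y C2.
have C4 := C1path_affine (y / (y - 1)) (- (y / (y - 1))) C2.
have C5 := C1path_affine (1 - y)^-1 (- (1 - y)^-1) C1.
pose L z := ln (modulus z).
have LM a b : a != 0 -> b != 0 -> L (a * b) = L a + L b by exact: ln_modulusM.
have LV a : a != 0 -> L a^-1 = - L a by exact: ln_modulusV.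
have LN a : L (- a) = L a by exact: ln_modulusN.
have B1 := @is_derive_BW _ _ _ (v / X) (v / (X - 1)) (L X) (L (1 - X)) C1 X0 X1.
have B3 := @is_derive_BW _ _ _ (- (v / X)) (v / (X - y) - v / X)
  (L y - L X) (L (X - y) - L X) C3.
have B4 := @is_derive_BW _ _ _ (v / (X - 1) - v / X) (v / (X - y) - v / X)
  (L (1 - X) + L y - L (1 - y) - L X) (L (X - y) - L (1 - y) - L X) C4.
have B5 := @is_derive_BW _ _ _ (v / (X - 1)) (v / (X - y))
  (L (1 - X) - L (1 - y)) (L (X - y) - L (1 - y)) C5.
rewrite /= -/X in B1 B3 B4 B5.
have e3 : 0 + y / X = y * X^-1 by rewrite add0r.
have e3' : 1 - (0 + y / X) = (X - y) * X^-1 by field.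
have e4 : y / (y - 1) + - (y / (y - 1)) / X = (1 - X) * y * (1 - y)^-1 * X^-1.
  by field; rewrite X0 y1'' y1'.
have e4' : 1 - (y / (y - 1) + - (y / (y - 1)) / X) = (X - y) * (1 - y)^-1 * X^-1.
  by field; rewrite X0 y1'' y1'.
have e5 : (1 - y)^-1 + - (1 - y)^-1 * X = (1 - X) * (1 - y)^-1 by ring.
have e5' : 1 - ((1 - y)^-1 + - (1 - y)^-1 * X) = (X - y) * (1 - y)^-1 by field.
rewrite e3' e3 in B3; rewrite e4' e4 in B4; rewrite e5' e5 in B5.
have nv z : z != 0 -> z^-1 != 0 by rewrite invr_eq0.
have m0 := mulf_neq0.
have n3 : y / X != 1.
  by rewrite -subr_eq0 (_ : _ - 1 = - ((X - y) / X)); [rewrite oppr_eq0 m0 ?nv|field].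
have n4 : (1 - X) * y * (1 - y)^-1 * X^-1 != 1.
  rewrite -subr_eq0 (_ : _ - 1 = - ((X - y) * (1 - y)^-1 * X^-1)).
    by rewrite oppr_eq0 !m0 ?nv.
  by field; rewrite X0 y1''.
have n5 : (1 - X) / (1 - y) != 1.
  by rewrite -subr_eq0 (_ : _ - 1 = - ((X - y) / (1 - y))); [rewrite oppr_eq0 m0 ?nv|field].
have D1 := B1 _ _ (erefl _) (erefl _).
have D3 := B3 (m0 _ _ _ y0 (nv _ X0)) n3.
have D4 := B4 (m0 _ _ _ (m0 _ _ _ (m0 _ _ _ X1'' y0) (nv _ y1'')) (nv _ X0)) n4.
have D5 := B5 (m0 _ _ _ X1'' (nv _ y1'')) n5.
have E : (fun u => BW_five_term (x + rc u * v) y) = 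
  (fun u => BlochWigner (x + rc u * v) + - BlochWigner y
    + BlochWigner (0 + y * (x + rc u * v)^-1)
    + - BlochWigner (y / (y - 1) + - (y / (y - 1)) * (x + rc u * v)^-1)
    + BlochWigner ((1 - y)^-1 + - (1 - y)^-1 * (x + rc u * v))).
  apply/funext => u; rewrite /BW_five_term add0r.
  have -> : (1 - (x + rc u * v)^-1) / (1 - y^-1) =
     y / (y - 1) + - (y / (y - 1)) * (x + rc u * v)^-1.
    by move: (_^-1) => w; field; rewrite y0 y1'.
  by rewrite (_ : (1 - (x + rc u * v)) / (1 - y) = 
    (1 - y)^-1 + - (1 - y)^-1 * (x + rc u * v)); [|ring].
rewrite E.
apply: (is_derive_eq (is_derive_fD (is_derive_fD (is_derive_fD (is_derive_fD
  (D1 _ _) (is_derive_fcst (- BlochWigner y) t)) (D3 _ _ _ _))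
  (is_derive_fN (D4 _ _ _ _))) (D5 _ _ _ _))).
- by [].
- by field; rewrite ?y0 ?y1' ?y1'' ?X0 ?X1' ?X1'' ?Xy'.
- by field; rewrite ?y0 ?y1' ?y1'' ?X0 ?X1' ?X1'' ?Xy'.
- by field; rewrite ?y0 ?y1' ?y1'' ?X0 ?X1' ?X1'' ?Xy'.
- by rewrite -[LHS]/(L _) LM ?nv// LV.
- by rewrite -[LHS]/(L _) LM ?nv// LV.
- by field; rewrite ?y0 ?y1' ?y1'' ?X0 ?X1' ?X1'' ?Xy'.
- by field; rewrite ?y0 ?y1' ?y1'' ?X0 ?X1' ?X1'' ?Xy'.
- by rewrite -[LHS]/(L _) !LM ?m0 ?nv// !LV.
- by rewrite -[LHS]/(L _) !LM ?m0 ?nv// !LV.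
- by field; rewrite ?y0 ?y1' ?y1'' ?X0 ?X1' ?X1'' ?Xy'.
- by field; rewrite ?y0 ?y1' ?y1'' ?X0 ?X1' ?X1'' ?Xy'.
- by rewrite -[LHS]/(L _) LM ?nv// LV.
- by rewrite -[LHS]/(L _) LM ?nv// LV.
- by rewrite !imD !imN; ring.
Qed.

End FiveTermDerivative.

Section FiveTermRelation.
Variable R : realType.
Implicit Types (x y z : C R) (t s : R).

Lemma five_term_nondegenerate x y : x != 0 -> x != 1 -> y != 0 -> y != 1 -> x != y ->
  [/\ y / x != 0 /\ y / x != 1,
      (1 - x^-1) / (1 - y^-1) != 0 /\ (1 - x^-1) / (1 - y^-1) != 1 &
      (1 - x) / (1 - y) != 0 /\ (1 - x) / (1 - y) != 1].
Proof.
move=> x0 x1 y0 y1 xy.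
have neq1 (z w : C R) : z - 1 = w -> w != 0 -> z != 1 by move=> <-; rewrite subr_eq0.
have [x1' y1'] : 1 - x != 0 /\ 1 - y != 0 by rewrite !subr_eq0 ![1 == _]eq_sym.
have [x1'' y1''] : x - 1 != 0 /\ y - 1 != 0 by rewrite !subr_eq0.
have [xy' yx'] : x - y != 0 /\ y - x != 0 by rewrite !subr_eq0 [y == x]eq_sym.
have e : (1 - x^-1) / (1 - y^-1) = (x - 1) * y / (x * (y - 1)).
  by field; rewrite x0 y0 y1''.
rewrite e; split; (split; first by rewrite !(mulf_neq0, invr_eq0)).
- by apply: (@neq1 _ ((y - x) / x)); [field|rewrite mulf_neq0 ?invr_eq0].
- apply: (@neq1 _ ((x - y) / (x * (y - 1)))); first by field; rewrite x0 y1''.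
  by rewrite !(mulf_neq0, invr_eq0).
- by apply: (@neq1 _ ((y - x) / (1 - y))); [field|rewrite mulf_neq0 ?invr_eq0].
Qed.

(** Exchanging x and y inverts the last three arguments. This makes the second variable movable as
    well. *)
Lemma BW_five_term_antisym x y : x != 0 -> x != 1 -> y != 0 -> y != 1 -> x != y ->
  BW_five_term y x = - BW_five_term x y.
Proof.
move=> x0 x1 y0 y1 xy.
have [[_ n3] [_ n4] [_ n5]] := five_term_nondegenerate x0 x1 y0 y1 xy.
rewrite /BW_five_term -(invf_div y x) BlochWigner_inv//.
rewrite -(invf_div (1 - x^-1)) BlochWigner_inv//.
by rewrite -(invf_div (1 - x)) BlochWigner_inv//; ring.
Qed.

Lemma BW_five_term_move x v y : y != 0 -> y != 1 ->
  (forall t, 0 <= t <= 1 -> [/\ x + rc t * v != 0, x + rc t * v != 1 & x + rc t * v != y]) ->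
  BW_five_term x y = BW_five_term (x + v) y.
Proof.
move=> y0 y1 h.
have := derive0_const (fun t ht => let: And3 h0 h1 hy := h t ht in
  is_derive_BW_five_term y0 y1 h0 h1 hy).
by rewrite rc0 mul0r addr0 rc1 mul1r.
Qed.

(** The target is -1 or 2, unless x is real already. From a nonreal x, the segment reaches the real
    axis only at its end, so that 0 and 1 are avoided and only y can be in the way. A real y is
    avoided by choosing a target different from it. A nonreal y on the segment towards 2 is not on
    the one towards -1, since these segments meet only in x. *)
Lemma BW_five_term_to_real x y : x != 0 -> x != 1 -> y != 0 -> y != 1 -> x != y ->
  exists2 a : R, [/\ rc a != 0 :> C R, rc a != 1 :> C R & rc a != y] &
    BW_five_term x y = BW_five_term (rc a) y.
Proof.
move=> x0 x1 y0 y1 xy; have [b0|b0] := eqVneq (im x) 0.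
  by rewrite (real_rc b0) in x0 x1 xy *; exists (re x).
have real_neq (a b : R) : a != b -> rc a != rc b :> C R.
  by apply: contra => /eqP[->].
have via (a : R) : a != 0 -> a != 1 -> rc a != y ->
    (forall t, 0 <= t < 1 -> x + rc t * (rc a - x) != y) ->
    exists2 a : R, [/\ rc a != 0 :> C R, rc a != 1 :> C R & rc a != y] &
      BW_five_term x y = BW_five_term (rc a) y.
  move=> a0 a1 ay h; exists a.
    by rewrite -rc0 -rc1 !real_neq.
  rewrite (@BW_five_term_move x (rc a - x) y)//; first by rewrite (addrC x) subrK.
  move=> t /andP[t0]; rewrite le_eqVlt => /predU1P[->|t1].
    rewrite rc1 mul1r (addrC x) subrK.
    by split=> //; [exact: (real_neq a 0)|exact: (real_neq a 1)].
  have imt : im (x + rc t * (rc a - x)) != 0.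
    rewrite !cE /= mul0r addr0 (_ : _ + _ = (1 - t) * im x); last by ring.
    by rewrite mulf_neq0// subr_eq0 gt_eqF.
  by split; [exact: (im_neq0_neq 0 imt)|exact: (im_neq0_neq 1 imt)|rewrite h// t0].
have n0 : (-1 : R) != 0 by rewrite lt_eqF//; lra.
have n1 : (-1 : R) != 1 by rewrite lt_eqF//; lra.
have n2 : (2 : R) != 1 by rewrite gt_eqF//; lra.
have n3 : (2 : R) != 0 by rewrite gt_eqF//; lra.
have [yr|yi] := eqVneq (im y) 0.
  have hy a t : 0 <= t < 1 -> x + rc t * (rc a - x) != y.
    move=> /andP[t0 t1]; apply/eqP => e; move: yr; rewrite -e.
    rewrite !cE /= mul0r addr0 (_ : _ + _ = (1 - t) * im x); last by ring.
    by move=> /eqP; rewrite mulf_eq0 (negbTE b0) orbF subr_eq0 gt_eqF.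
  have [e|ne] := eqVneq (rc (-1)) y; last first.
    exact: (via (-1) n0 n1 ne (hy (-1))).
  apply: (via 2 n3 n2 _ (hy 2)).
  by rewrite -e real_neq// gt_eqF//; lra.
have ya a : rc a != y by rewrite eq_sym; exact: im_neq0_neq.
have [h|] := pselect (forall t, 0 <= t < 1 -> x + rc t * (rc 2 - x) != y).
  exact: (via 2 n3 n2 (ya 2) h).
move=> /existsNP[s] /not_implyP[/andP[s0 s1] /negP/negPn/eqP ys].
apply: (via (-1) n0 n1 (ya _)).
move=> t /andP[t0 t1]; apply: contraNneq xy => yt.
have := ys; rewrite -yt => e.
have e1 := congr1 (@im R) e; have e2 := congr1 (@re R) e.
move: e1 e2; rewrite !cE /= !mul0r !addr0 !subr0 => e1 e2.
have st : s = t.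
  have /eqP : (t - s) * im x = 0.
    rewrite (_ : _ * _ = (im x + s * - im x) - (im x + t * - im x)); last by ring.
    by move: e1; rewrite !add0r => ->; rewrite subrr.
  by rewrite mulf_eq0 (negbTE b0) orbF subr_eq0 => /eqP ->.
move: e2; rewrite st => e2.
have t00 : t = 0 by lra.
by rewrite t00 rc0 mul0r addr0.
Qed.

Lemma BlochWigner_five_term x y : x != 0 -> x != 1 -> y != 0 -> y != 1 -> x != y ->
  BW_five_term x y = 0.
Proof.
move=> x0 x1 y0 y1 xy.
have [a [a0 a1 ay] ->] := BW_five_term_to_real x0 x1 y0 y1 xy.
have ya : y != rc a by rewrite eq_sym.
rewrite -[LHS]opprK -BW_five_term_antisym//.
have [b [b0 b1 ba] ->] := BW_five_term_to_real y0 y1 a0 a1 ya.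
have [[_ n3] [_ n4] [_ n5]] := five_term_nondegenerate b0 b1 a0 a1 ba.
have inv0 (c : C R) : im c = 0 -> im c^-1 = 0 by rewrite imV => ->; rewrite mul0r oppr0.
have sub0 (c : R) : im (1 - rc c) = 0 by rewrite !cE /= subr0.
have mul0 (c d : C R) : im c = 0 -> im d = 0 -> im (c * d) = 0.
  by rewrite imM => -> ->; rewrite mulr0 mul0r addr0.
rewrite /BW_five_term !BlochWigner_real ?subr0 ?addr0 ?oppr0//.
- by apply: mul0 => //; apply: inv0.
- by rewrite -!rcV; apply: mul0 => //; apply: inv0.
- by apply: mul0 => //; apply: inv0.
Qed.

End FiveTermRelation.

(** * The homomorphism on the pre-Bloch group and its functional equations *)

Section BlochHom.
Local Open Scope quotient_scope.
Variable R : realType.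
Implicit Types (x y z : C R).

Definition BW_free (g : {freeg (punctured (C R)) / int}) : R :=
  fglift (fun u : punctured (C R) => BlochWigner (val u) : zmodule R) g.

Lemma BW_free_is_additive : zmod_morphism BW_free.
Proof.
exact: (@lift_is_additive _ _ _
  (fun u : punctured (C R) => BlochWigner (val u) : zmodule R)).
Qed.

HB.instance Definition _ := GRing.isZmodMorphism.Build _ _ BW_free BW_free_is_additive.

Lemma BW_free_gen x : x != 0 -> x != 1 -> BW_free (gen x) = BlochWigner x.
Proof.
move=> x0 x1; rewrite /gen; case: insubP => [u _ ux|]; last by rewrite x0 x1.
by rewrite /BW_free liftU ux scale1r.
Qed.

Lemma BW_free_subgroup g : g \in @five_term_subgroup (C R) -> BW_free g = 0.
Proof.
(* The subgroup is an intersection of subgroups, so membership can be tested against the kernel of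
   [BW_free]. *)
move=> /asboolP /(_ [pred g | BW_free g == 0]) H; apply/eqP; apply: H.
  split; first by rewrite inE raddf0.
  by move=> u v; rewrite !inE => /eqP hu /eqP hv; rewrite raddfB /= hu hv subr0.
move=> x y x0 x1 y0 y1 xy; rewrite inE /five_term !(raddfD, raddfB, raddfN) /=.
have [[? ?] [? ?] [? ?]] := five_term_nondegenerate x0 x1 y0 y1 xy.
rewrite !BW_free_gen//.
by rewrite -/(BW_five_term x y) BlochWigner_five_term.
Qed.

Definition BW_hom (q : preBloch (C R)) : R := BW_free (repr q).

Lemma BW_hom_pi g : BW_hom (\pi g) = BW_free g.
Proof.
apply/eqP; rewrite -subr_eq0 /BW_hom -raddfB; apply/eqP/BW_free_subgroup.
by rewrite Quotient.idealrBE reprK.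
Qed.

Lemma BW_hom_is_additive : zmod_morphism BW_hom.
Proof.
move=> p q; rewrite -[p]reprK -[q]reprK -raddfB !BW_hom_pi.
exact: raddfB.
Qed.

HB.instance Definition _ := GRing.isZmodMorphism.Build _ _ BW_hom BW_hom_is_additive.

(** It is 0 at 0 and 1, where [gen] is 0; with these values the functional equations below hold for
    all arguments. *)
Definition BW x := BW_hom (bloch x).

Lemma BWE x : x != 0 -> x != 1 -> BW x = BlochWigner x.
Proof. by move=> x0 x1; rewrite /BW BW_hom_pi BW_free_gen. Qed.

Lemma BW0 : BW 0 = 0.
Proof. by rewrite /BW BW_hom_pi /gen insubF ?eqxx// raddf0. Qed.

Lemma BW1 : BW 1 = 0.
Proof. by rewrite /BW BW_hom_pi /gen insubF ?eqxx ?andbF// raddf0. Qed.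

Lemma BW_inv x : BW x^-1 = - BW x.
Proof.
have [->|x0] := eqVneq x 0; first by rewrite invr0 BW0 oppr0.
have [->|x1] := eqVneq x 1; first by rewrite invr1 BW1 oppr0.
by rewrite !BWE ?invr_eq0 ?invr_eq1//; exact: BlochWigner_inv.
Qed.

Lemma BW_conj x : BW (conjc x) = - BW x.
Proof.
have [->|x0] := eqVneq x 0; first by rewrite rmorph0 BW0 oppr0.
have [->|x1] := eqVneq x 1; first by rewrite rmorph1 BW1 oppr0.
have x1' : conjc x != 1 by rewrite -(rmorph1 (@conjc R)) (inj_eq (can_inj (@conjcK R))).
rewrite !BWE ?conjc_eq0//.
have [b0|b0] := eqVneq (im x) 0; last exact: BlochWigner_conj.
rewrite !BlochWigner_real ?oppr0//.
by case: x b0 {x0 x1 x1'} => a b /= ->; rewrite oppr0.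
Qed.

(** For nonreal x, the sum D(x) + D(1 - x) has derivative zero along the segment from x to 2, which
    misses 0 and 1. At the end both terms are values at real points and vanish. *)
Lemma BW_1m x : BW (1 - x) = - BW x.
Proof.
have [->|x0] := eqVneq x 0; first by rewrite subr0 BW0 BW1 oppr0.
have [->|x1] := eqVneq x 1; first by rewrite subrr BW0 BW1 oppr0.
have n1 : 1 - x != 0 by rewrite subr_eq0 eq_sym.
have n2 : 1 - x != 1 by rewrite -subr_eq0 addrAC subrr add0r oppr_eq0.
rewrite !BWE//.
have [b0|b0] := eqVneq (im x) 0.
  by rewrite !BlochWigner_real ?oppr0//; rewrite imD imN b0 subr0.
have e t : im (x + rc t * (rc 2 - x)) = (1 - t) * im x by rewrite !cE /=; ring.
have h t : 0 <= t <= 1 -> x + rc t * (rc 2 - x) != 0 /\ x + rc t * (rc 2 - x) != 1.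
  move=> /andP[t0]; rewrite le_eqVlt => /predU1P[->|t1].
    rewrite rc1 mul1r addrC subrK -rc0 -rc1.
    split; apply/eqP => -[] /eqP; first by rewrite pnatr_eq0.
    by rewrite gt_eqF//; lra.
  have imt : im (x + rc t * (rc 2 - x)) != 0 by rewrite e mulf_neq0// subr_eq0 gt_eqF.
  by split; [exact: (im_neq0_neq 0 imt)|exact: (im_neq0_neq 1 imt)].
pose v := rc 2 - x.
have dH (t : R) : 0 <= t <= 1 ->
    is_derive t (1 : R) (fun u => BlochWigner (x + rc u * v)
      + BlochWigner (1 + -1 * (x + rc u * v))) 0.
  move=> /h; rewrite -/v; set X := x + rc t * v => -[X0 X1].
  have X1' : X - 1 != 0 by rewrite subr_eq0.
  have X1'' : 1 - X != 0 by rewrite -opprB oppr_eq0.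
  have C1 := C1path_line x v t.
  have C2 := C1path_affine 1 (-1) C1.
  have B1 := @is_derive_BW _ _ _ _ (v / X) (v / (X - 1)) _ _ C1 X0 X1 _ _ erefl erefl.
  have B2 := @is_derive_BW _ _ _ _ (v / (X - 1)) (v / X)
    (ln (modulus (1 - X))) (ln (modulus X)) C2.
  rewrite /= -/X mulN1r in B2.
  apply: (is_derive_eq (is_derive_fD (B1 _ _) (B2 _ _ _ _ _ _))).
  - by [].
  - by rewrite -/X; field; rewrite X1' X1''.
  - by [].
  - by rewrite -subr_eq0 addrAC subrr add0r oppr_eq0.
  - by field; rewrite X1' X1''.
  - by field; rewrite X0.
  - by [].
  - by rewrite opprB addrC subrK.
  - by rewrite -/X; ring.
have := derive0_const dH; rewrite rc0 rc1 mul0r mul1r addr0 !mulN1r /v (addrC x) subrK.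
have im2 : im (1 - rc 2 : C R) = 0 by rewrite !cE /= subr0.
have ne : rc 2 != 1 :> C R by rewrite -rc1; apply/eqP => -[] /eqP; rewrite gt_eqF//; lra.
have ne' : 1 - rc 2 != 1 :> C R.
  by rewrite -rc1 -rcN -rcD; apply/eqP => -[] /eqP; rewrite lt_eqF//; lra.
have im0 : im (rc 2 : C R) = 0 by [].
rewrite (BlochWigner_real im2 ne') (BlochWigner_real im0 ne).
by rewrite addr0 => /eqP; rewrite addrC addr_eq0 => /eqP.
Qed.

(* The five-term relation in a form which, with division by zero giving zero,
   also holds in all degenerate cases. *)
Lemma BW_five x y : BW x - BW y + BW (y / x)
  - BW (((x - 1) * y) / ((y - 1) * x)) + BW ((1 - x) / (1 - y)) = 0.
Proof.
have [->|x0] := eqVneq x 0.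
  by rewrite !(invr0, mulr0, mul0r, subr0, BW0, mul1r) BW_inv BW_1m; ring.
have [->|y0] := eqVneq y 0.
  by rewrite !(mul0r, mulr0, subr0, BW0, divr1) BW_1m; ring.
have [->|x1] := eqVneq x 1.
  by rewrite !(divr1, subrr, mul0r, BW0, BW1); ring.
have [->|y1] := eqVneq y 1.
  by rewrite !(mul1r, subrr, mul0r, invr0, mulr0, BW0, BW1) BW_inv; ring.
have y1' : y - 1 != 0 by rewrite subr_eq0.
have x1' : x - 1 != 0 by rewrite subr_eq0.
have [x1'' y1''] : 1 - x != 0 /\ 1 - y != 0 by rewrite !subr_eq0 ![1 == _]eq_sym.
have [<-|xy] := eqVneq x y.
  by rewrite !divff ?mulf_neq0// BW1; ring.
have := BlochWigner_five_term x0 x1 y0 y1 xy.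
have <- : (1 - x^-1) / (1 - y^-1) = ((x - 1) * y) / ((y - 1) * x).
  by field; rewrite x0 y0 y1'.
have [[? ?] [? ?] [? ?]] := five_term_nondegenerate x0 x1 y0 y1 xy.
by rewrite !BWE.
Qed.

End BlochHom.

(** * Volume of a CR tetrahedron as a sum over its faces *)

Section QuadIdentity.
Variable R : realType.
Implicit Types (x y z : C R).

Lemma BW_fiveE x y t2 t3 t4 : y / x = t2 ->
  (x - 1) * y / ((y - 1) * x) = t3 -> (1 - x) / (1 - y) = t4 ->
  BW x - BW y + BW t2 - BW t3 + BW t4 = 0.
Proof. by move=> <- <- <-; exact: BW_five. Qed.

(** Two sign changes cancel. This lemma and the next one match terms of different five-term
    relations with each other. *)
Lemma BW_conj_1m x y : y = 1 - conjc x -> BW y = BW x.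
Proof. by move=> ->; rewrite BW_1m BW_conj opprK. Qed.

Lemma BW_conj_inv x y : y = (conjc x)^-1 -> BW y = BW x.
Proof. by move=> ->; rewrite BW_inv BW_conj opprK. Qed.

Local Ltac field_nonzero :=
  field; repeat (apply/andP; split); assumption.

Local Ltac field_nonzero_or K :=
  case: (eqVneq K 0) => [->|?];
    [rewrite !(mul0r, oppr0, invr0, mulr0)|field_nonzero].

(** The sums a + b, A + d, b + d stand for <p3, p0>, <p3, p1>, <p2, p3>, and the last hypothesis for
    <p3, p3> = 0. Let Xi and Yi be the values at the first and second arguments of the relation
    [Ri]. The left-hand side is 2 V with V = X0 - X1 + X2 - X3. Each of [R0], ..., [R3] contains one
    face term; in R0 - R1 + R2 - R3 the remaining terms cancel by the symmetries, which leaves V =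
    (Y0 - Y1 + Y2 - Y3) + (right-hand side). By the symmetries again, R4 + R5 reads V + (Y0 - Y1 +
    Y2 - Y3) = 0. *)
Lemma BW_quad (a b d A B D : C R) :
  conjc a = A -> conjc b = B -> conjc d = D ->
  a != 0 -> b != 0 -> d != 0 -> a + b != 0 -> A + d != 0 -> b + d != 0 ->
  a + b + d + A + B + D = 0 ->
  2 * (BW (b / (a + b)) + BW ((A + d) / d) + BW (- B / D) + BW (- (a + D) / (A + B)))
  = BW (- ((A + d) * D * (b + d)) / ((a + D) * d * (B + D)))
    - BW (- ((a + b) * B * (b + d)) / ((A + B) * b * (B + D)))
    + BW (- (A * (a + D) * (a + b)) / (a * (A + d) * (A + B)))
    - BW (- (A * D * b) / (a * d * B)).
Proof.
move=> ca cb cd a0 b0 d0; set s := a + b; set m := A + d; set n := b + d.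
move=> s0 m0 n0 rel.
have cA : conjc A = a by rewrite -ca conjcK.
have cB : conjc B = b by rewrite -cb conjcK.
have cD : conjc D = d by rewrite -cd conjcK.
set S := A + B; set M := a + D; set N := B + D.
(* [K] and its conjugate [L] may be zero. In the relations below [L] enters numerators only, but [K]
   also enters denominators. *)
pose K := b * A - a * d; pose L := B * a - A * D.
have cs : conjc s = S by rewrite /s rmorphD /= ca cb.
have cm : conjc m = M by rewrite /m rmorphD /= cA cd.
have cn : conjc n = N by rewrite /n rmorphD /= cb cd.
have cS : conjc S = s by rewrite -cs conjcK.
have cM : conjc M = m by rewrite -cm conjcK.
have cN : conjc N = n by rewrite -cn conjcK.
have cK : conjc K = L by rewrite /K rmorphB !rmorphM /= cA cb ca cd.
have cL : conjc L = K by rewrite -cK conjcK.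
have A0 : A != 0 by rewrite -ca conjc_eq0.
have B0 : B != 0 by rewrite -cb conjc_eq0.
have D0 : D != 0 by rewrite -cd conjc_eq0.
have S0 : S != 0 by rewrite -cs conjc_eq0.
have M0 : M != 0 by rewrite -cm conjc_eq0.
have N0 : N != 0 by rewrite -cn conjc_eq0.
have eD : D = - (a + b + d + A + B).
  by apply: (addrI (a + b + d + A + B)); rewrite subrr; exact: rel.
have eL1 : L = - (S * N + B * n) by rewrite /L /S /N /n eD; ring.
have eL2 : L = N * M + D * n by rewrite /L /M /N /n eD; ring.
have eK1 : b * N + K = - (n * s) by rewrite /K /n /N /s eD; ring.
have eK2 : d * N - K = - (n * m) by rewrite /K /n /N /m eD; ring.
have en : S + M = - n by rewrite /S /M /n eD; ring.
have eN : m + s = - N by rewrite /m /s /N eD; ring.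
have eK3 : A * s - a * m = K by rewrite /K /s /m; ring.
have es : s = a + b by []. have em : m = A + d by [].
have eS : S = A + B by []. have eM : M = a + D by [].
have enn : n = b + d by []. have eNN : N = B + D by [].
have eK : K = b * A - a * d by [].
clearbody s m n S M N K L.
have x0 : - a / b - 1 = - (s / b) by rewrite es; field.
have y0 : - L / (B * n) - 1 = S * N / (B * n) by rewrite eL1; field; rewrite n0 B0.
have x1 : - A / d - 1 = - (m / d) by rewrite em; field.
have y1 : L / (D * n) - 1 = N * M / (D * n) by rewrite eL2; field; rewrite n0 D0.
have x2 : - B / D - 1 = - (N / D) by rewrite eNN; field.
have y2 : b * A / (a * d) - 1 = K / (a * d) by rewrite eK; field; rewrite a0 d0.
have x3 : - S / M - 1 = n / M by rewrite -[n]opprK -en; field.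
have y3 : A * s / (a * m) - 1 = K / (a * m) by rewrite -eK3; field; rewrite a0 m0.
have x4 : - d / b - 1 = - (n / b) by rewrite enn; field.
have y4 : - m / s - 1 = N / s by rewrite -[N]opprK -eN; field.
have x5 : S / B - 1 = A / B by rewrite eS; field.
have y5 : M / D - 1 = a / D by rewrite eM; field.
have sub1 x y : x - 1 = y -> 1 - x = - y by move=> <-; rewrite opprB.
have R0 := @BW_fiveE (- a / b) (- L / (B * n)) (L * b / (B * n * a))
  (- (s * L) / (S * N * a)) (- (s * B * n) / (S * b * N)).
rewrite x0 y0 (sub1 _ _ x0) (sub1 _ _ y0) in R0.
have R1 := @BW_fiveE (- A / d) (L / (D * n)) (- (L * d) / (D * n * A))
  (m * L / (N * M * A)) (- (m * D * n) / (M * d * N)).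
rewrite x1 y1 (sub1 _ _ x1) (sub1 _ _ y1) in R1.
have R2 := @BW_fiveE (- B / D) (b * A / (a * d)) (- (A * D * b) / (a * d * B))
  (N * b * A / (K * B)) (- (N * a * d) / (K * D)).
rewrite x2 y2 (sub1 _ _ x2) (sub1 _ _ y2) in R2.
have R3 := @BW_fiveE (- S / M) (A * s / (a * m)) (- (A * M * s) / (a * m * S))
  (- (n * A * s) / (K * S)) (n * a * m / (K * M)).
rewrite x3 y3 (sub1 _ _ x3) (sub1 _ _ y3) in R3.
have R4 := @BW_fiveE (- d / b) (- m / s) (m * b / (s * d))
  (- (n * m) / (N * d)) (- (n * s) / (b * N)).
rewrite x4 y4 (sub1 _ _ x4) (sub1 _ _ y4) in R4.
have R5 := @BW_fiveE (S / B) (M / D) (M * B / (D * S))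
  (A * M / (a * S)) (A * D / (B * a)).
rewrite x5 y5 (sub1 _ _ x5) (sub1 _ _ y5) in R5.
(* The facts [M1], ..., [M13] identify terms of different relations; [Z0], [Z1] and [Z3] express
   values on the left-hand side by the first terms of [R0], [R1] and [R3]. *)
have M1 : BW (S / B) = BW (- a / b).
  by apply: BW_conj_1m; rewrite fmorph_div rmorphN /= ca cb eS; field.
have Z0 : BW (b / s) = BW (- a / b).
  rewrite (_ : b / s = (1 - - a / b)^-1); first by rewrite BW_inv BW_1m opprK.
  by rewrite (_ : 1 - - a / b = s / b) ?invf_div// es; field.
have M2 : BW (- (n * s) / (b * N)) = BW (- L / (B * n)).
  apply: BW_conj_1m; rewrite fmorph_div rmorphM rmorphN /= cL cB cn -eK1.
  by field; rewrite b0 N0.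
have M3 : BW (N * b * A / (K * B)) = BW (L * b / (B * n * a)).
  apply: BW_conj_inv; rewrite fmorph_div !rmorphM /= cL cB cn ca cb invf_div.
  by congr (_ / _); ring.
have M4 : BW (- (n * A * s) / (K * S)) = BW (- (s * L) / (S * N * a)).
  apply: BW_conj_inv; rewrite fmorph_div !rmorphM rmorphN rmorphM /= cL cS cN ca cs invf_div.
  by rewrite invrN mulrN mulNr; congr (- (_ / _)); ring.
have M5 : BW (M / D) = BW (- A / d).
  by apply: BW_conj_1m; rewrite fmorph_div rmorphN /= cA cd eM; field.
have Z1 : BW (m / d) = - BW (- A / d).
  by rewrite -BW_1m; congr BW; rewrite em; field.
have M6 : BW (- (n * m) / (N * d)) = BW (L / (D * n)).
  apply: BW_conj_1m; rewrite fmorph_div rmorphM /= cL cD cn -eK2.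
  by field; rewrite d0 N0.
have M7 : BW (- (N * a * d) / (K * D)) = BW (- (L * d) / (D * n * A)).
  apply: BW_conj_inv; rewrite fmorph_div !rmorphM rmorphN rmorphM /= cL cD cn cA cd invf_div.
  by rewrite invrN mulrN mulNr; congr (- (_ / _)); ring.
have M8 : BW (n * a * m / (K * M)) = BW (m * L / (N * M * A)).
  apply: BW_conj_inv; rewrite fmorph_div !rmorphM /= cL cN cM cA cm invf_div.
  by congr (_ / _); ring.
have M9 : BW (- d / b) = BW (- B / D).
  apply: BW_conj_inv; rewrite fmorph_div rmorphN /= cB cD invf_div.
  by rewrite invrN mulrN mulNr.
have M10 : BW (A * D / (B * a)) = BW (b * A / (a * d)).
  apply: BW_conj_inv; rewrite fmorph_div !rmorphM /= cA cb ca cd invf_div.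
  by congr (_ / _); ring.
have M11 : BW (- m / s) = BW (- S / M).
  apply: BW_conj_inv; rewrite fmorph_div rmorphN /= cS cM invf_div.
  by rewrite invrN mulrN mulNr.
have Z3 : BW (- M / S) = - BW (- S / M).
  by rewrite -BW_inv invf_div invrN mulrN mulNr.
have M12 : BW (A * M / (a * S)) = BW (A * s / (a * m)).
  apply: BW_conj_inv; rewrite fmorph_div !rmorphM /= cA cs ca cm invf_div.
  by congr (_ / _); ring.
have M13 : BW (M * B / (D * S)) = - BW (m * b / (s * d)).
  rewrite -BW_conj fmorph_div !rmorphM /= cm cb cs cd; congr BW.
  by congr (_ / _); ring.
have {}R0 := R0 ltac:(by field_nonzero) ltac:(by field_nonzero) ltac:(by field_nonzero).
have {}R1 := R1 ltac:(by field_nonzero) ltac:(by field_nonzero) ltac:(by field_nonzero).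
have {}R4 := R4 ltac:(by field_nonzero) ltac:(by field_nonzero) ltac:(by field_nonzero).
have {}R5 := R5 ltac:(by field_nonzero) ltac:(by field_nonzero) ltac:(by field_nonzero).
(* If [K] is zero, division by zero makes both sides of the remaining two conditions 0. *)
have {}R2 := R2 ltac:(by field_nonzero) ltac:(by field_nonzero_or K) ltac:(by field_nonzero_or K).
have {}R3 := R3 ltac:(by field_nonzero) ltac:(by field_nonzero_or K) ltac:(by field_nonzero_or K).
rewrite M1 M5 M13 M12 M10 in R5; rewrite M9 M11 M6 M2 in R4.
rewrite M4 M8 in R3; rewrite M3 M7 in R2.
rewrite Z0 Z1 Z3; move: R0 R1 R2 R3 R4 R5; clear.
repeat match goal with |- context [BW ?t] => move: (BW t) => ? end.
lra.
Qed.

End QuadIdentity.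

(** * Null vectors, polar vectors and triple products *)

Section Hermitian.
Local Open Scope quotient_scope.
Variable R : realType.
Implicit Types (z w c : 'cV[C R]_3) (p q r : S3 R).

Definition co z (k : nat) : C R := z (inord k) 0.

Lemma hermE z w : herm z w =
  conjc (co w 2) * co z 0 + conjc (co w 1) * co z 1 + conjc (co w 0) * co z 2.
Proof.
have o0 : (ord0 : 'I_3) = inord 0 by apply: val_inj; rewrite /= inordK.
have o1 : lift ord0 ord0 = inord 1 :> 'I_3 by apply: val_inj; rewrite /= inordK.
have o2 : lift ord0 (lift ord0 ord0) = inord 2 :> 'I_3 by apply: val_inj; rewrite /= inordK.
rewrite /herm !mxE !big_ord_recl big_ord0 !mxE !big_ord_recl !big_ord0 !mxE.
have cjE (x : C R) : Num.conj x = conjc x by [].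
rewrite !o2 !o1 !o0 !inordK// !addSn !add0n !eqSS /= !cjE /co.
by rewrite !(mulr0, mulr1, add0r, addr0) addrA.
Qed.

Lemma coP z w : (forall k, (k < 3)%N -> co z k = co w k) -> z = w.
Proof.
move=> h; apply/matrixP => i j; rewrite ord1.
by have := h i (ltn_ord i); rewrite /co inord_val.
Qed.

Lemma coD z w k : co (z + w) k = co z k + co w k. Proof. by rewrite /co mxE. Qed.
Lemma coZ (a : C R) z k : co (a *: z) k = a * co z k. Proof. by rewrite /co mxE. Qed.

Lemma hermDl z z' w : herm (z + z') w = herm z w + herm z' w.
Proof. by rewrite !hermE !coD; ring. Qed.
Lemma hermZl (a : C R) z w : herm (a *: z) w = a * herm z w.
Proof. by rewrite !hermE !coZ; ring. Qed.
Lemma hermC z w : herm w z = conjc (herm z w).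
Proof. by rewrite !hermE !rmorphD !rmorphM /= !conjcK; ring. Qed.
Lemma hermDr z z' w : herm w (z + z') = herm w z + herm w z'.
Proof. by rewrite hermC hermDl rmorphD /= -!hermC. Qed.
Lemma hermZr (a : C R) z w : herm w (a *: z) = conjc a * herm w z.
Proof. by rewrite hermC hermZl rmorphM /= -!hermC. Qed.

Lemma conjc_mul_eq0 (x : C R) : conjc x * x = 0 -> x = 0.
Proof. by move=> /eqP; rewrite mulf_eq0 conjc_eq0 orbb => /eqP. Qed.

(** A form of signature (2, 1) has no totally isotropic plane. The combination [v] of z and w is
    null with last coordinate 0, which makes its middle coordinate 0; if co z 2 != 0, then <v, z> =
    0 forces v = 0. Otherwise z and w are both multiples of the first basis vector. *)
Lemma herm_isotropic_plane z w : herm z z = 0 -> herm w w = 0 -> herm z w = 0 ->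
  z != 0 -> w != 0 -> exists a : C R, w = a *: z.
Proof.
have vecE v : (co v 2 = 0 -> co v 1 = 0 -> v != 0 -> co v 0 != 0).
  move=> e2 e1; apply: contra => /eqP e0; apply/eqP/coP => -[|[|[|]]]// _.
  - by rewrite e0 /co mxE.
  - by rewrite e1 /co mxE.
  - by rewrite e2 /co mxE.
move=> hz hw hzw z0 w0.
pose v := co w 2 *: z + (- co z 2) *: w.
have hv : herm v v = 0.
  rewrite /v !(hermDl, hermDr, hermZl, hermZr) hz hw (hermC z w) hzw rmorph0.
  by rewrite !(mulr0, addr0).
have v2 : co v 2 = 0 by rewrite /v coD !coZ; ring.
have v1 : co v 1 = 0.
  by move: hv; rewrite hermE v2 rmorph0 mul0r mulr0 add0r addr0 => /conjc_mul_eq0.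
have null2 u : herm u u = 0 -> co u 2 = 0 -> co u 1 = 0.
  by move=> hu u2; move: hu; rewrite hermE u2 rmorph0 mul0r mulr0 add0r addr0 => /conjc_mul_eq0.
have [z2|z2] := eqVneq (co z 2) 0; last first.
  have hvz : herm v z = 0 by rewrite /v hermDl !hermZl hz (hermC z w) hzw rmorph0 !mulr0 addr0.
  have v0 : co v 0 = 0.
    move: hvz; rewrite hermE v1 v2 !mulr0 !addr0 => /eqP.
    by rewrite mulf_eq0 conjc_eq0 (negbTE z2) => /eqP.
  have ve : v = 0.
    by clearbody v; apply: coP => -[|[|[|]]]// _; rewrite [RHS]/co mxE.
  exists (co w 2 / co z 2); move: ve; rewrite /v scaleNr => /eqP; rewrite subr_eq0 => /eqP e.
  by rewrite mulrC -scalerA e scalerA mulVf ?scale1r.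
have z1 := null2 _ hz z2.
have zn := vecE _ z2 z1 z0.
have w2 : co w 2 = 0.
  move: hzw; rewrite hermE z1 z2 !mulr0 !addr0 => /eqP.
  by rewrite mulf_eq0 conjc_eq0 (negbTE zn) orbF => /eqP.
have w1 := null2 _ hw w2.
exists (co w 0 / co z 0); apply: coP => -[|[|[|]]]// _; rewrite coZ.
- by rewrite mulfVK.
- by rewrite z1 w1 mulr0.
- by rewrite z2 w2 mulr0.
Qed.

Lemma hat_neq0 p : hat p != 0.
Proof. by rewrite /hat /lift_CP2; set u := repr _; exact: (set_mem (valP u)). Qed.

Lemma herm_hat p : herm (hat p) (hat p) = 0.
Proof. exact: set_mem (valP p). Qed.

Lemma hat_inj p q (a : C R) : hat p = a *: hat q -> p = q.
Proof.
move=> h; apply: val_inj.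
rewrite -[val p]reprK -[val q]reprK; apply/eqmodP/asboolP; exists a.
exact: h.
Qed.

Lemma herm_hat_neq0 p q : p <> q -> herm (hat p) (hat q) != 0.
Proof.
move=> pq; apply/eqP => h; apply: pq.
have [a ha] := herm_isotropic_plane (herm_hat p) (herm_hat q) h (hat_neq0 p) (hat_neq0 q).
exact/esym/(hat_inj ha).
Qed.

Lemma herm_nondeg c : (forall z, herm z c = 0) -> c = 0.
Proof.
move=> h; apply: coP => k k3; rewrite [RHS]/co mxE.
have e (i j : 'I_3) : co (delta_mx i 0) j = (j == i)%:R :> C R.
  by rewrite /co inord_val mxE eqxx andbT.
have o (k' : nat) (hk : (k' < 3)%N) (i : 'I_3) : co (delta_mx i 0) k' = (k' == i)%:R :> C R.
  by have := e i (Ordinal hk).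
case: k k3 => [|[|[|]]]// _.
- have := h (delta_mx (@Ordinal 3 2 isT) 0); rewrite hermE !o//=.
  by rewrite !(mulr0, add0r, mulr1) => /eqP; rewrite conjc_eq0 => /eqP.
- have := h (delta_mx (@Ordinal 3 1 isT) 0); rewrite hermE !o//=.
  by rewrite !(mulr0, add0r, addr0, mulr1) => /eqP; rewrite conjc_eq0 => /eqP.
- have := h (delta_mx (@Ordinal 3 0 isT) 0); rewrite hermE !o//=.
  by rewrite !(mulr0, addr0, mulr1) => /eqP; rewrite conjc_eq0 => /eqP.
Qed.

(** The vector [c] is J applied to the conjugate of the cross product of z and w. If it were zero,
    all 2 by 2 minors would vanish and w would be a multiple of z. *)
Lemma exists_polar z w : z != 0 -> (forall a : C R, w <> a *: z) ->
  exists c, [/\ c != 0, herm z c = 0 & herm w c = 0].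
Proof.
move=> z0 zw.
pose n0 := co z 1 * co w 2 - co z 2 * co w 1.
pose n1 := co z 2 * co w 0 - co z 0 * co w 2.
pose n2 := co z 0 * co w 1 - co z 1 * co w 0.
pose c : 'cV[C R]_3 := \col_(i < 3) conjc
  (if i == 0 :> nat then n2 else if i == 1%N :> nat then n1 else n0).
have c0 : co c 0 = conjc n2 by rewrite /co mxE inordK.
have c1 : co c 1 = conjc n1 by rewrite /co mxE inordK.
have c2 : co c 2 = conjc n0 by rewrite /co mxE inordK.
exists c; split.
- apply/eqP => ce.
  have m0 : n0 = 0 by apply/eqP; rewrite -conjc_eq0 -c2 ce /co mxE.
  have m1 : n1 = 0 by apply/eqP; rewrite -conjc_eq0 -c1 ce /co mxE.
  have m2 : n2 = 0 by apply/eqP; rewrite -conjc_eq0 -c0 ce /co mxE.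
  move/eqP: m0 m1 m2; rewrite /n0 /n1 /n2 subr_eq0.
  move=> /eqP m0 /eqP; rewrite subr_eq0 => /eqP m1 /eqP; rewrite subr_eq0 => /eqP m2.
  have [y0|y0] := eqVneq (co z 0) 0; last first.
    apply: (zw (co w 0 / co z 0)); apply: coP => -[|[|[|]]]// _; rewrite coZ.
    + by rewrite mulfVK.
    + by rewrite mulrAC [_ * co z 1]mulrC -m2 mulrAC mulfV ?mul1r.
    + by rewrite mulrAC [_ * co z 2]mulrC m1 mulrAC mulfV ?mul1r.
  have [y1|y1] := eqVneq (co z 1) 0; last first.
    apply: (zw (co w 1 / co z 1)); apply: coP => -[|[|[|]]]// _; rewrite coZ.
    + by rewrite mulrAC [_ * co z 0]mulrC m2 mulrAC mulfV ?mul1r.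
    + by rewrite mulfVK.
    + by rewrite mulrAC [_ * co z 2]mulrC -m0 mulrAC mulfV ?mul1r.
  have y2 : co z 2 != 0.
    apply: contra z0 => /eqP y2; apply/eqP/coP => -[|[|[|]]]// _; rewrite [RHS]/co mxE.
    + exact: y0.
    + exact: y1.
    + exact: y2.
  apply: (zw (co w 2 / co z 2)); apply: coP => -[|[|[|]]]// _; rewrite coZ.
  + by rewrite mulrAC [_ * co z 0]mulrC -m1 mulrAC mulfV ?mul1r.
  + by rewrite mulrAC [_ * co z 1]mulrC m0 mulrAC mulfV ?mul1r.
  + by rewrite mulfVK.
- by rewrite hermE c0 c1 c2 !conjcK /n0 /n1 /n2; ring.
- by rewrite hermE c0 c1 c2 !conjcK /n0 /n1 /n2; ring.
Qed.

Lemma polarP p q : p <> q ->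
  [/\ polar p q != 0, herm (hat p) (polar p q) = 0 & herm (hat q) (polar p q) = 0].
Proof.
move=> pq.
have [c hc] : exists c, [/\ c != 0, herm (hat p) c = 0 & herm (hat q) c = 0].
  apply: exists_polar; first exact: hat_neq0.
  by move=> a /hat_inj e; apply: pq.
exact: (@xgetPex _ 0
  [set c | [/\ c != 0, herm (hat p) c = 0 & herm (hat q) c = 0]] (ex_intro _ c hc)).
Qed.

(** The scaling factors of the lifts are the same in numerator and denominator, so any lifts may be
    used. *)
Lemma cross_ratioE (p : 'I_4 -> S3 R) (W : 'I_4 -> 'cV[C R]_3) (l : 'I_4 -> C R) i j k m :
  (forall a, l a != 0) -> (forall a, W a = l a *: hat (p a)) ->
  let c := polar (p i) (p j) in
  cross_ratio p i j k m =
  (herm (W m) c * herm (W k) (W i)) / (herm (W k) c * herm (W m) (W i)).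
Proof.
move=> l0 hW c; rewrite /cross_ratio -/c !hW !(hermZl, hermZr).
have li : conjc (l i) != 0 by rewrite conjc_eq0.
move: (herm (hat (p m)) c) (herm (hat (p k)) c) => x1 x2.
move: (herm (hat (p k)) (hat (p i))) (herm (hat (p m)) (hat (p i))) => y1 y2.
rewrite (_ : l m * x1 * _ = (l m * l k * conjc (l i)) * (x1 * y1)); last by ring.
rewrite (_ : l k * x2 * _ = (l m * l k * conjc (l i)) * (x2 * y2)); last by ring.
by rewrite -[RHS]mulf_div divff ?mul1r// !mulf_neq0.
Qed.

(** The Hermitian triple product; the argument of its opposite is the Cartan angular invariant. *)
Definition triple z w u : C R := herm z w * herm w u * herm u z.

Lemma triple_cycle z w u : triple w u z = triple z w u.
Proof.
by rewrite /triple; move: (herm z w) (herm w u) (herm u z) => x y t; ring.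
Qed.

Definition face_inv p q r : R :=
  BW (- triple (hat p) (hat q) (hat r) / conjc (triple (hat p) (hat q) (hat r))).

(** Rescaling the lifts multiplies the triple product by the positive real number |a|^2 |b|^2 |c|^2,
    which drops out of the quotient by the conjugate. *)
Lemma face_invE p q r (a b c : C R) z w u : a != 0 -> b != 0 -> c != 0 ->
  z = a *: hat p -> w = b *: hat q -> u = c *: hat r ->
  face_inv p q r = BW (- triple z w u / conjc (triple z w u)).
Proof.
move=> a0 b0 c0 -> -> ->; rewrite /face_inv; congr BW.
pose t := a * conjc a * (b * conjc b) * (c * conjc c).
have t0 : t != 0 by rewrite !mulf_neq0// conjc_eq0.
have -> : triple (a *: hat p) (b *: hat q) (c *: hat r) = t * triple (hat p) (hat q) (hat r).
  by rewrite /triple !(hermZl, hermZr) /t; ring.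
have ct : conjc t = t by rewrite /t !rmorphM /= !conjcK; ring.
move: (triple _ _ _) => T; clearbody t.
by rewrite rmorphM /= ct -mulrN -[RHS]mulf_div divff ?mul1r.
Qed.

Lemma face_inv_swap p q r : face_inv q p r = - face_inv p q r.
Proof.
rewrite /face_inv -BW_inv; congr BW.
have -> : triple (hat q) (hat p) (hat r) = conjc (triple (hat p) (hat q) (hat r)).
  by rewrite /triple !rmorphM /= -!hermC; ring.
by rewrite conjcK invf_div invrN mulrN mulNr.
Qed.

Lemma face_inv_cycle p q r : face_inv q r p = face_inv p q r.
Proof. by rewrite /face_inv triple_cycle. Qed.

Lemma herm_unitary (A : 'M[C R]_3) z w : U21 A -> herm (A *m z) (A *m w) = herm z w.
Proof.
move=> UA; rewrite /herm; congr (fun_of_matrix _ 0 0).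
have -> : adjoint (A *m w) = adjoint w *m adjoint A.
  by rewrite /adjoint map_mxM trmx_mul.
by rewrite -!mulmxA (mulmxA (adjoint A)) (mulmxA (adjoint A *m _)) UA.
Qed.

Lemma face_inv_PU21 g p q r : PU21 g -> face_inv (g p) (g q) (g r) = face_inv p q r.
Proof.
move=> [A UA hg].
have hg' s : exists2 a : C R, a != 0 & A *m hat s = a *: hat (g s).
  have [a ha] := hg s; have a0 : a != 0.
    by apply: contra_neq (hat_neq0 (g s)) => a0; rewrite ha a0 scale0r.
  by exists a^-1; [rewrite invr_eq0|rewrite ha scalerA mulVf ?scale1r].
have [[a a0 ea] [b b0 eb] [c c0 ec]] := And3 (hg' p) (hg' q) (hg' r).
rewrite (face_invE a0 b0 c0 ea eb ec) /face_inv; congr BW.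
by rewrite /triple !herm_unitary.
Qed.

Lemma span2P (z w u : 'cV[C R]_3) :
  reflect (exists a b : C R, u = a *: z + b *: w) (u \in (<[z]> + <[w]>)%VS).
Proof.
apply: (iffP memv_addP) => [[u1 /vlineP[a ->] [u2 /vlineP[b ->] ->]]|[a [b ->]]].
  by exists a, b.
by exists (a *: z); [by apply/vlineP; exists a|exists (b *: w) => //; apply/vlineP; exists b].
Qed.

Lemma dim_span2 (z w : 'cV[C R]_3) : z != 0 -> w \notin <[z]>%VS ->
  \dim (<[z]> + <[w]>)%VS = 2.
Proof.
move=> z0 wz; have w0 : w != 0 by apply: contraNneq wz => ->; exact: mem0v.
rewrite dimv_disjoint_sum ?dim_vline ?z0 ?w0//.
apply/eqP; rewrite -subv0; apply/subvP => u; rewrite memv_cap => /andP[/vlineP[a ->] /vlineP[b]].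
have [->|b0] := eqVneq b 0; first by rewrite scale0r => ->; exact: mem0v.
move=> e; case/negP: wz; apply/vlineP; exists (b^-1 * a).
by rewrite -scalerA e scalerA mulVf ?scale1r.
Qed.

(** The points of S3 with lifts in the span of two of them form a C-circle, so genericity gives the
    linear independence of any three lifts. *)
Lemma generic_span (p : 'I_4 -> S3 R) i j k : generic p -> i != j -> j != k -> i != k ->
  hat (p k) \notin (<[hat (p i)]> + <[hat (p j)]>)%VS.
Proof.
move=> [pinj pgen] ij jk ik; apply/negP => h.
have pij : p i <> p j by move=> /pinj /eqP; rewrite (negbTE ij).
apply: (pgen i j k ij jk ik); set L := (_ + _)%VS in h.
exists [set q | hat q \in L]; split => //=.
- exists L; split => //.
    apply: dim_span2; first exact: hat_neq0.
    by apply/negP => /vlineP[a] /hat_inj e; apply: pij.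
  exists (p i), (p j); split => //=.
  + by apply/span2P; exists 1, 0; rewrite scale1r scale0r addr0.
  + by apply/span2P; exists 0, 1; rewrite scale1r scale0r add0r.
- by apply/span2P; exists 1, 0; rewrite scale1r scale0r addr0.
- by apply/span2P; exists 0, 1; rewrite scale1r scale0r add0r.
Qed.

Lemma generic_basis (z w u v : 'cV[C R]_3) : z != 0 -> w \notin <[z]>%VS ->
  u \notin (<[z]> + <[w]>)%VS -> exists a b c : C R, v = a *: z + b *: w + c *: u.
Proof.
move=> z0 wz uzw.
have u0 : u != 0 by apply: contraNneq uzw => ->; exact: mem0v.
have full : (<[z]> + <[w]> + <[u]> = fullv)%VS.
  apply/eqP; rewrite eqEdim subvf /= dimvf /dim /=.
  rewrite dimv_disjoint_sum ?dim_vline ?u0 ?dim_span2//.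
  apply/eqP; rewrite -subv0; apply/subvP => x; rewrite memv_cap => /andP[hx /vlineP[a xa]].
  have [a0|a0] := eqVneq a 0; first by rewrite xa a0 scale0r mem0v.
  case/negP: uzw; rewrite -[u]scale1r -(mulVf a0) -scalerA -xa.
  by rewrite memvZ.
have : v \in (<[z]> + <[w]> + <[u]>)%VS by rewrite full memvf.
move=> /memv_addP[x /span2P[a [b ->]] [y /vlineP[c ->] ->]].
by exists a, b, c.
Qed.

Definition face_val z w u : R := BW (- triple z w u / conjc (triple z w u)).

#[local] Opaque herm.

(** A polar vector is orthogonal to two of the lifts, and w3 = w0 + w1 + w2 then relates its
    products with the other two: <w3, k01> = <w2, k01>, but <w1, k23> = - <w0, k23>. These nonzero
    factors cancel, and the cross-ratios become the four arguments on the left of [BW_quad]. *)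
Lemma volume_vectors (w0 w1 w2 w3 k01 k10 k23 k32 : 'cV[C R]_3) :
  w3 = w0 + w1 + w2 ->
  [/\ herm w0 w0 = 0, herm w1 w1 = 0, herm w2 w2 = 0 & herm w3 w3 = 0] ->
  [/\ herm w1 w0 != 0, herm w2 w0 != 0 & herm w2 w1 != 0] ->
  [/\ herm w3 w0 != 0, herm w3 w1 != 0 & herm w2 w3 != 0] ->
  (forall k, k != 0 -> herm w0 k = 0 -> herm w1 k = 0 -> herm w2 k = 0 -> False) ->
  [/\ k01 != 0, herm w0 k01 = 0 & herm w1 k01 = 0] ->
  [/\ k10 != 0, herm w1 k10 = 0 & herm w0 k10 = 0] ->
  [/\ k23 != 0, herm w2 k23 = 0 & herm w3 k23 = 0] ->
  [/\ k32 != 0, herm w3 k32 = 0 & herm w2 k32 = 0] ->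
  2 * (BW ((herm w3 k01 * herm w2 w0) / (herm w2 k01 * herm w3 w0))
    + BW ((herm w2 k10 * herm w3 w1) / (herm w3 k10 * herm w2 w1))
    + BW ((herm w1 k23 * herm w0 w2) / (herm w0 k23 * herm w1 w2))
    + BW ((herm w0 k32 * herm w1 w3) / (herm w1 k32 * herm w0 w3))) =
  face_val w1 w2 w3 - face_val w0 w2 w3 + face_val w0 w1 w3 - face_val w0 w1 w2.
Proof.
move=> ew3 [h00 h11 h22 h33] [x0 y0 d0] [xy0 Ad0 yd0] nd.
move=> [c1 c1' c1''] [c2 c2' c2''] [c3 c3' c3''] [c4 c4' c4''].
have kE k : herm w3 k = herm w0 k + herm w1 k + herm w2 k by rewrite ew3 !hermDl.
have drop1 (x y z : C R) : x = 0 -> x + y + z = y + z by move=> ->; rewrite add0r.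
have drop2 (x y z : C R) : y = 0 -> x + y + z = x + z by move=> ->; rewrite addr0.
have drop3 (x y z : C R) : z = 0 -> x + y + z = x + y by move=> ->; rewrite addr0.
have drop12 (x y z : C R) : x = 0 -> y = 0 -> x + y + z = z.
  by move=> -> ->; rewrite !add0r.
have k1 := etrans (kE k01) (drop12 _ _ _ c1' c1'').
have n1 : herm w2 k01 != 0 by apply/eqP; exact (nd k01 c1 c1' c1'').
have k2 := etrans (kE k10) (drop12 _ _ _ c2'' c2').
have n2 : herm w2 k10 != 0 by apply/eqP; exact (nd k10 c2 c2'' c2').
have k3' : herm w0 k23 + herm w1 k23 = 0 by rewrite -[RHS]c3'' kE c3' addr0.
have k3 : herm w1 k23 = - herm w0 k23 by apply/eqP; rewrite -addr_eq0 addrC k3'.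
have opp0 (x y : C R) : x = - y -> y = 0 -> x = 0 by move=> -> ->; rewrite oppr0.
have n3 : herm w0 k23 != 0.
  by apply/eqP => h; exact (nd k23 c3 h (opp0 _ _ k3 h) c3').
have k4' : herm w0 k32 + herm w1 k32 = 0 by rewrite -[RHS]c4' kE c4'' addr0.
have k4 : herm w0 k32 = - herm w1 k32 by apply/eqP; rewrite -addr_eq0 k4'.
have n4 : herm w1 k32 != 0.
  by apply/eqP => h; exact (nd k32 c4 (opp0 _ _ k4 h) h c4'').
have h30 := etrans (kE w0) (drop1 _ _ _ h00).
have h31 := etrans (kE w1) (drop2 _ _ _ h11).
have h32 := etrans (kE w2) (drop3 _ _ _ h22).
have kE' k : herm k w3 = herm k w0 + herm k w1 + herm k w2 by rewrite ew3 !hermDr.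
have h03 := etrans (kE' w0) (drop1 _ _ _ h00).
have h13 := etrans (kE' w1) (drop2 _ _ _ h11).
have h23 := etrans (kE' w2) (drop3 _ _ _ h22).
have fE z w u : face_val z w u = BW (- (herm z w * herm w u * herm u z) /
   (herm w z * herm u w * herm z u)).
  by rewrite /face_val /triple !rmorphM /= -!hermC.
rewrite !fE; have cx := esym (hermC w1 w0).
have cy := esym (hermC w2 w0).
have cd := esym (hermC w2 w1).
rewrite (kE w3) in h33.
rewrite !h03 !h13 !h23 in h33; rewrite !h30 in xy0; rewrite !h31 in Ad0; rewrite !h23 in yd0.
rewrite k1 k2 k3 k4 !h30 !h31 !h32 !h03 !h13 !h23.
move: n1 n2 n3 n4 h33 xy0 Ad0 yd0 x0 y0 d0 cx cy cd.
move: (herm w2 k01) (herm w2 k10) (herm w0 k23) (herm w1 k32) => p1 p2 p3 p4.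
move: (herm w1 w0) (herm w2 w0) (herm w2 w1) (herm w0 w1) (herm w0 w2) (herm w1 w2).
clear => x y d A B D n1 n2 n3 n4 rel xy0 Ad0 yd0 x0 y0 d0 cx cy cd.
have canc (p u v : C R) : p != 0 -> (p * u) / (p * v) = u / v.
  by move=> p0; rewrite -mulf_div (divff p0) mul1r.
have cancN (p u v : C R) : p != 0 -> (- p * u) / (p * v) = - u / v.
  by move=> p0; rewrite mulNr -mulrN canc.
rewrite (canc p1 _ _ n1) (canc p2 _ _ n2) (cancN p3 _ _ n3) (cancN p4 _ _ n4).
have rel' : x + y + d + A + B + D = 0 by rewrite -[RHS]rel; ring.
rewrite (BW_quad cx cy cd x0 y0 d0 xy0 Ad0 yd0 rel').
rewrite (_ : (A + d) * D * (y + d) = D * (y + d) * (A + d)); last by ring.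
rewrite (_ : (x + D) * d * (B + D) = d * (B + D) * (x + D)); last by ring.
rewrite (_ : (x + y) * B * (y + d) = B * (y + d) * (x + y)); last by ring.
by rewrite (_ : (A + B) * y * (B + D) = y * (B + D) * (A + B)); last by ring.
Qed.

Definition e4 (k : nat) : 'I_4 := inord k.

(** The first three lifts form a basis. The coordinates of the fourth are nonzero by genericity and
    are absorbed into the lifts, which changes neither the cross-ratios nor the face terms. *)
Lemma volume_faces (p : 'I_4 -> S3 R) : generic p ->
  2 * (BW (z01 p) + BW (z10 p) + BW (z23 p) + BW (z32 p)) =
  face_inv (p (e4 1)) (p (e4 2)) (p (e4 3)) - face_inv (p (e4 0)) (p (e4 2)) (p (e4 3))
  + face_inv (p (e4 0)) (p (e4 1)) (p (e4 3)) - face_inv (p (e4 0)) (p (e4 1)) (p (e4 2)).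
Proof.
move=> gp; have [pinj _] := gp.
have ne (i j : nat) : (i < 4)%N -> (j < 4)%N -> i != j -> e4 i != e4 j.
  by move=> hi hj; apply: contra => /eqP /(congr1 val); rewrite /= !inordK// => ->.
have pne i j : i != j -> p i <> p j by move=> ij /pinj /eqP; rewrite (negbTE ij).
have nspan i j k := @generic_span p i j k gp.
pose P k := hat (p (e4 k)).
have n10 : P 1%N \notin <[P 0%N]>%VS.
  by apply/negP => /vlineP[a] /hat_inj; apply: pne; apply: ne.
have basis v := @generic_basis (P 0%N) (P 1%N) (P 2%N) v
  (hat_neq0 _) n10 (nspan _ _ _ (ne 0 1 isT isT isT) (ne 1 2 isT isT isT) (ne 0 2 isT isT isT)).
have [a [b [c e]]] := basis (P 3%N).
have a0 : a != 0.
  apply: contraNneq (nspan _ _ _ (ne 1 2 isT isT isT) (ne 2 3 isT isT isT)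
    (ne 1 3 isT isT isT)) => a0.
  by apply/span2P; exists b, c; rewrite -/(P 3%N) e a0 scale0r add0r.
have b0 : b != 0.
  apply: contraNneq (nspan _ _ _ (ne 0 2 isT isT isT) (ne 2 3 isT isT isT)
    (ne 0 3 isT isT isT)) => b0.
  by apply/span2P; exists a, c; rewrite -/(P 3%N) e b0 scale0r addr0.
have c0 : c != 0.
  apply: contraNneq (nspan _ _ _ (ne 0 1 isT isT isT) (ne 1 3 isT isT isT)
    (ne 0 3 isT isT isT)) => c0.
  by apply/span2P; exists a, b; rewrite -/(P 3%N) e c0 scale0r addr0.
pose l (i : 'I_4) : C R := if i == 0 :> nat then a else if i == 1%N :> nat then b
  else if i == 2%N :> nat then c else 1.
have [l0E l1E l2E l3E] : [/\ l (e4 0) = a, l (e4 1) = b, l (e4 2) = c & l (e4 3) = 1].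
  by rewrite /l /e4 !inordK.
have l0 i : l i != 0 by rewrite /l; do 3 case: ifP => // _; exact: oner_neq0.
clearbody l; pose W i := l i *: hat (p i).
have WE i : W i = l i *: hat (p i) by [].
have eW : W (e4 3) = W (e4 0) + W (e4 1) + W (e4 2).
  by rewrite !WE l0E l1E l2E l3E scale1r.
clearbody W.
have hW i : herm (W i) (W i) = 0 by rewrite WE hermZl hermZr herm_hat !mulr0.
have hn i j : i != j -> herm (W i) (W j) != 0.
  move=> ij; rewrite !WE hermZl hermZr !mulf_neq0 ?conjc_eq0//.
  by apply: herm_hat_neq0; exact: pne.
have nd d : d != 0 -> herm (W (e4 0)) d = 0 -> herm (W (e4 1)) d = 0 ->
    herm (W (e4 2)) d = 0 -> False.
  move=> d0 h0 h1 h2; move/eqP: d0; apply; apply: herm_nondeg => z.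
  have [a' [b' [c' ->]]] := basis z.
  have hP k : herm (W (e4 k)) d = 0 -> herm (P k) d = 0.
    by rewrite WE hermZl => /eqP; rewrite mulf_eq0 (negbTE (l0 _)) => /eqP.
  by rewrite !hermDl !hermZl !hP// !mulr0 !addr0.
have pol i j : i != j -> [/\ polar (p i) (p j) != 0, herm (W i) (polar (p i) (p j)) = 0
    & herm (W j) (polar (p i) (p j)) = 0].
  move=> ij; have [h1 h2 h3] := polarP (pne _ _ ij).
  by rewrite !WE !hermZl h2 h3 !mulr0.
have fE i j k : face_inv (p i) (p j) (p k) = face_val (W i) (W j) (W k).
  exact: face_invE (l0 i) (l0 j) (l0 k) (WE i) (WE j) (WE k).
have cE i j k m : cross_ratio p i j k m =
    (herm (W m) (polar (p i) (p j)) * herm (W k) (W i))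
    / (herm (W k) (polar (p i) (p j)) * herm (W m) (W i)).
  exact: cross_ratioE l0 WE.
have E01 : z01 p = _ := (cE (e4 0) (e4 1) (e4 2) (e4 3)).
have E10 : z10 p = _ := (cE (e4 1) (e4 0) (e4 3) (e4 2)).
have E23 : z23 p = _ := (cE (e4 2) (e4 3) (e4 0) (e4 1)).
have E32 : z32 p = _ := (cE (e4 3) (e4 2) (e4 1) (e4 0)).
rewrite E01 E10 E23 E32 (fE (e4 1) (e4 2) (e4 3)) (fE (e4 0) (e4 2) (e4 3)).
rewrite (fE (e4 0) (e4 1) (e4 3)) (fE (e4 0) (e4 1) (e4 2)).
apply: volume_vectors.
- exact: eW.
- by split; exact: hW.
- by split; apply: hn; apply: ne.
- by split; apply: hn; apply: ne.
- exact: nd.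
- exact: pol (ne 0 1 isT isT isT).
- exact: pol (ne 1 0 isT isT isT).
- exact: pol (ne 2 3 isT isT isT).
- exact: pol (ne 3 2 isT isT isT).
Qed.

End Hermitian.

(** * Cancellation over the face pairings *)

Section FaceCancellation.
Variables (S : Type) (R : realType) (f : S -> S -> S -> R).
Hypothesis f_swap : forall p q r, f q p r = - f p q r.
Hypothesis f_cycle : forall p q r, f q r p = f p q r.

(** The contribution of the face opposite to the vertex i, with the sign (-1)^i of the simplicial
    boundary. *)
Definition face_term (p : 'I_4 -> S) (i : 'I_4) : R :=
  if i == e4 0 then f (p (e4 1)) (p (e4 2)) (p (e4 3))
  else if i == e4 1 then - f (p (e4 0)) (p (e4 2)) (p (e4 3))
  else if i == e4 2 then f (p (e4 0)) (p (e4 1)) (p (e4 3))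
  else - f (p (e4 0)) (p (e4 1)) (p (e4 2)).

Lemma e4P (i : 'I_4) : [\/ i = e4 0, i = e4 1, i = e4 2 | i = e4 3].
Proof.
have e k (h : (k < 4)%N) : Ordinal h = e4 k by apply: val_inj; rewrite /= inordK.
case: i => [[|[|[|[|//]]]] h]; rewrite e.
- exact: Or41.
- exact: Or42.
- exact: Or43.
- exact: Or44.
Qed.

Lemma e4_eq (j k : nat) : (j < 4)%N -> (k < 4)%N -> (e4 j == e4 k) = (j == k).
Proof. by move=> hj hk; rewrite -val_eqE /= !inordK. Qed.

Lemma sum_face_term (p : 'I_4 -> S) :
  \sum_(i < 4) face_term p i
  = f (p (e4 1)) (p (e4 2)) (p (e4 3)) - f (p (e4 0)) (p (e4 2)) (p (e4 3))
    + f (p (e4 0)) (p (e4 1)) (p (e4 3)) - f (p (e4 0)) (p (e4 1)) (p (e4 2)).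
Proof.
rewrite !big_ord_recl big_ord0 addr0 -!addrA.
have e k (i : 'I_4) : val i = k -> i = e4 k.
  by move=> <-; rewrite /e4 inord_val.
have [-> -> -> ->] : [/\ lift ord0 (lift ord0 (lift ord0 ord0)) = e4 3,
    lift ord0 (lift ord0 ord0) = e4 2, lift ord0 ord0 = e4 1 & ord0 = e4 0].
  by split; exact: e.
by rewrite /face_term !e4_eq.
Qed.

Lemma face_term_tperm (p : 'I_4 -> S) x y i : x != y ->
  face_term (fun a => p (tperm x y a)) i = - face_term p (tperm x y i).
Proof.
have tE z : tperm x y z = if z == x then y else if z == y then x else z.
  by case: tpermP => [->|->|/eqP/negbTE -> /eqP/negbTE ->]; rewrite ?eqxx//; case: eqP.
have perms a b c : [/\ f b a c = - f a b c, f b c a = f a b c, f c a b = f a b c,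
    f a c b = - f a b c & f c b a = - f a b c].
  have h1 : f c a b = f a b c by rewrite (f_cycle c a b).
  have h2 : f a c b = - f a b c by rewrite (f_swap c a b) h1.
  by split; rewrite // ?(f_swap a b c) ?(f_cycle a b c) ?(f_cycle a c b).
(* For each face, the five nontrivial reorderings of its vertices; what remains is a finite check
   over x, y and i. *)
have [A1 A2 A3 A4 A5] := perms (p (e4 1)) (p (e4 2)) (p (e4 3)).
have [B1 B2 B3 B4 B5] := perms (p (e4 0)) (p (e4 2)) (p (e4 3)).
have [C1 C2 C3 C4 C5] := perms (p (e4 0)) (p (e4 1)) (p (e4 3)).
have [D1 D2 D3 D4 D5] := perms (p (e4 0)) (p (e4 1)) (p (e4 2)).
rewrite /face_term !tE; clear tE perms.
by case: (e4P x) => ->; case: (e4P y) => ->; case: (e4P i) => ->;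
  rewrite !e4_eq//= ?e4_eq//= => _;
  rewrite ?(A1, A2, A3, A4, A5, B1, B2, B3, B4, B5, C1, C2, C3, C4, C5, D1, D2, D3, D4, D5)
   ?opprK.
Qed.

(** With these signs the terms are alternating under relabelling all four vertices, so that only the
    parity of a pairing matters. Transpositions generate. *)
Lemma face_term_perm (t : {perm 'I_4}) (p : 'I_4 -> S) i :
  face_term (fun a => p (t a)) i = (-1) ^+ odd_perm t * face_term p (t i).
Proof.
have [ts -> dts] := prod_tpermP t.
elim: ts dts p i => [_ p i|[x y] ts IH /= /andP[xy dts] p i].
  rewrite big_nil odd_perm1 mul1r perm1; congr (face_term _ _).
  by apply/funext => a; rewrite perm1.
rewrite big_cons /= odd_permM odd_tperm xy signr_addb expr1 -mulrA permM -IH// mulN1r.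
rewrite -[RHS](face_term_tperm (fun a => p ((\prod_(u <- ts) tperm u.1 u.2)%g a))) //.
by congr (face_term _ _); apply/funext => a; rewrite permM.
Qed.

Lemma face_term_cancel (P : face_pairing) (v : 'I_(ntet P) -> 'I_4 -> S) :
  (forall (s : 'I_(ntet P)) (i : 'I_4), 
     exists2 h : S -> S, (forall p q r, f (h p) (h q) (h r) = f p q r) &
     forall a, a != i -> v s a = h (v (Defs.glue (s, i)).1 ((Defs.glue (s, i)).2 a))) ->
  \sum_(s < ntet P) \sum_(i < 4) face_term (v s) i = 0.
Proof.
move=> hv; pose F (u : 'I_(ntet P) * 'I_4) := face_term (v u.1) u.2.
pose o (u : 'I_(ntet P) * 'I_4) := ((Defs.glue u).1, (Defs.glue u).2 u.2).
have oK : involutive o by move=> [s i]; rewrite /o /= glue_invol /= permK.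
have Fo u : F (o u) = - F u.
  case: u => s i; rewrite /F /o /=.
  have [h hf hs] := hv s i.
  (* The term of the face opposite to i does not involve the vertex i, so the relation for a != i is
     enough. *)
  have -> : face_term (v s) i =
      face_term (fun a => v (Defs.glue (s, i)).1 ((Defs.glue (s, i)).2 a)) i.
    rewrite /face_term.
    have ne (j k : nat) : (j < 4)%N -> (k < 4)%N -> j != k -> e4 j != e4 k.
      by move=> hj hk; rewrite e4_eq.
    by case: (e4P i) hs => -> hs; rewrite !e4_eq//= !hs ?ne// hf.
  by rewrite face_term_perm glue_oriented expr1 mulN1r opprK.
rewrite pair_big /= -/F.
have : \sum_u F u = - \sum_u F u.
  rewrite {1}(reindex_inj (inv_inj oK)) /= -sumrN.
  by apply: eq_bigr => u _; exact: Fo.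
by move=> h; rewrite -[LHS]/(\sum_u F u); lra.
Qed.

End FaceCancellation.

(** * Uniqueness of lifts to a covering *)

Section Lifting.
Variables (R : realType) (E B : topologicalType) (p : E -> B).

Lemma within_continuousP (X Y : topologicalType) (A : set X) (f : X -> Y) :
  {within A, continuous f} <->
  forall x, A x -> forall W, nbhs (f x) W -> \forall y \near x, A y -> W (f y).
Proof.
split.
  by move=> /subspace_continuousP h x Ax W nW; exact: (h x Ax W nW).
by move=> h; apply/subspace_continuousP => x Ax W nW; exact: (h x Ax W nW).
Qed.

Lemma within_continuous_comp (X Y Z : topologicalType) (A : set X) (A' : set Y)
    (f : X -> Y) (g : Y -> Z) :
  {within A, continuous f} -> (forall x, A x -> A' (f x)) ->
  {within A', continuous g} -> {within A, continuous (g \o f)}.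
Proof.
move=> /within_continuousP cf AA' /within_continuousP cg; apply/within_continuousP.
move=> x Ax W nW; have := cf x Ax _ (cg _ (AA' x Ax) _ nW).
by apply: filterS => y /= h Ay; apply: h => //; exact: AA'.
Qed.

(** Both the agreement set and its complement are open in [0, 1]. Near a common value the lifts stay
    in one sheet, on which [p] is injective. Near different values each stays in its own sheet;
    agreement at a nearby point would identify the two sheets, and then the values as well. *)
Lemma covering_lift_unique (u v : R -> E) : covering p ->
  {within `[0%R, 1%R], continuous u} -> {within `[0%R, 1%R], continuous v} ->
  (forall t, 0 <= t <= 1 -> p (u t) = p (v t)) -> u 0 = v 0 ->
  forall t, 0 <= t <= 1 -> u t = v t.
Proof.
move=> [_ _ cov] /within_continuousP cu /within_continuousP cv puv uv0.
pose A : set R := `[0%R, 1%R].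
have AE t : A t <-> 0 <= t <= 1 by rewrite /A /= in_itv.
have local t : A t ->
    [/\ u t = v t -> \forall s \near t, A s -> u s = v s &
        u t <> v t -> \forall s \near t, A s -> u s <> v s].
  move=> At; have [U [oU Ub [I [V [pU tV hV]]]]] := cov (p (u t)).
  have [i _ Vi] : (\bigcup_i V i) (u t) by rewrite -pU.
  have [j _ Vj] : (\bigcup_i V i) (v t) by rewrite -pU /= -puv//; exact/AE.
  have nV k x : V k x -> nbhs x (V k).
    by move=> Vx; have [[oV _ _ _] _] := hV k; exact: open_nbhs_nbhs.
  have inj k : {in V k &, injective p} by have [[_ h _ _] _] := hV k.
  split=> e.
  - rewrite -e in Vj; have Vi' : V i (v t) by rewrite -e.
    have h1 := cu t At _ (nV _ _ Vi); have h2 := cv t At _ (nV _ _ Vi').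
    near=> s => As; apply: (inj i); rewrite ?inE.
    + by move: As; near: s.
    + by move: As; near: s.
    + by apply: puv; exact/AE.
  - have h1 := cu t At _ (nV _ _ Vi); have h2 := cv t At _ (nV _ _ Vj).
    near=> s => As us.
    have Vis : V i (u s) by move: (As); near: s.
    have Vjs : V j (v s) by move: (As); near: s.
    apply: e; have ij : i = j.
      by apply: (tV i j) => //; exists (u s); split => //; rewrite us.
    apply: (inj i); rewrite ?inE//; first by rewrite ij.
    by apply: puv; exact/AE.
have conn : connected A by exact: segment_connected.
pose D : set R := [set t | A t /\ u t = v t].
have : D = A.
  apply: conn.
  - by exists 0; split => //; apply/AE; rewrite lexx ler01.
  - exists (interior [set t | A t -> u t = v t]); first exact: open_interior.
    apply/seteqP; split => t.
    + by move=> [At e]; split => //; exact: (local t At).1.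
    + by move=> [At /nbhs_singleton /= h]; split => //; exact: h.
  - exists (~` interior [set t | A t -> u t <> v t]).
      by rewrite closedC; exact: open_interior.
    apply/seteqP; split => t.
    + by move=> [At e]; split => // /nbhs_singleton /= /(_ At).
    + move=> [At h]; split => //; apply: contrapT => ne; apply: h.
      exact: (local t At).2.
by move=> DA t /AE At; have [] : D t by rewrite DA.
Unshelve. all: by end_near. Qed.

End Lifting.

Section Simplices.
Variable R : realType.
Implicit Types (x y : 'rV[R]_4) (t : {perm 'I_4}).

Lemma relabel_permE t x a : relabel t x 0 (t a) = x 0 a.
Proof. by rewrite /relabel mxE permK. Qed.

Lemma relabel_mxE t x a : relabel t x 0 a = x 0 (t^-1%g a).
Proof. by rewrite /relabel mxE. Qed.

Lemma relabel_simplex t x : simplex x -> simplex (relabel t x).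
Proof.
move=> [x0 x1]; split; first by move=> a; rewrite relabel_mxE.
rewrite -x1 (reindex_inj (@perm_inj _ t)) /=.
by apply: eq_bigr => a _; rewrite relabel_permE.
Qed.

Definition is_vertex x := exists a, x = vertex R a.

Lemma relabel_vertex t x : is_vertex (relabel t x) -> is_vertex x.
Proof.
move=> [a h]; exists (t^-1%g a); apply/rowP => b.
by rewrite -(relabel_permE t) h !mxE /= (canF_eq (permK t)).
Qed.

Lemma vertex_simplex a : simplex (vertex R a).
Proof.
split; first by move=> b; rewrite mxE ler0n.
rewrite (bigD1 a) //= big1 ?addr0 ?mxE ?eqxx//.
by move=> b ba; rewrite mxE (negbTE ba) andbF.
Qed.

Definition segment x y (s : R) : 'rV[R]_4 := x + s *: (y - x).

Lemma segmentE x y s a : segment x y s 0 a = (1 - s) * x 0 a + s * y 0 a.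
Proof. by rewrite !mxE; ring. Qed.

Lemma segment0 x y : segment x y 0 = x.
Proof. by rewrite /segment scale0r addr0. Qed.

Lemma segment1 x y : segment x y 1 = y.
Proof. by rewrite /segment scale1r addrC subrK. Qed.

Lemma segment_continuous x y : continuous (segment x y).
Proof.
move=> s; apply: cvgD; first exact: cvg_cst.
by apply: cvgZl; exact: cvg_id.
Qed.

Lemma relabel_segment t x y s :
  relabel t (segment x y s) = segment (relabel t x) (relabel t y) s.
Proof. by apply/rowP => a; rewrite segmentE !relabel_mxE segmentE. Qed.

Lemma segment_simplex x y s : 0 <= s <= 1 -> simplex x -> simplex y ->
  simplex (segment x y s).
Proof.
move=> /andP[s0 s1] [x0 x1] [y0 y1]; split.
  by move=> a; rewrite segmentE addr_ge0// mulr_ge0// subr_ge0.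
under eq_bigr do rewrite segmentE.
by rewrite big_split /= -!mulr_sumr x1 y1 !mulr1 subrK.
Qed.

Lemma segment_face x y s i : 0 <= s <= 1 -> face i x -> face i y ->
  face i (segment x y s).
Proof.
move=> hs [sx xi] [sy yi]; split; first exact: segment_simplex.
by rewrite segmentE xi yi !mulr0 addr0.
Qed.

(** Vertices are extreme points of the simplex: if 1 - s > 0, a coordinate which vanishes on the
    combination vanishes at x. *)
Lemma segment_vertex x y s : 0 <= s <= 1 -> simplex x -> simplex y ->
  is_vertex (segment x y s) -> is_vertex x \/ is_vertex y.
Proof.
move=> /andP[s0 s1] sx sy [b hb].
have [e|sn] := eqVneq s 1; first by right; exists b; rewrite -hb e segment1.
left; exists b; case: (sx) => x0 x1.
have xc c : c != b -> x 0 c = 0.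
  move=> cb; have := congr1 (fun z : 'rV[R]_4 => z 0 c) hb.
  rewrite segmentE [RHS]mxE (negbTE cb) andbF => /eqP.
  have s1' : 0 < 1 - s by rewrite subr_gt0 lt_neqAle sn s1.
  rewrite paddr_eq0; last 2 first.
  - by rewrite mulr_ge0// ltW.
  - by rewrite mulr_ge0//; case: sy.
  by move=> /andP[]; rewrite mulf_eq0 (gt_eqF s1') /= => /eqP.
apply/rowP => c; rewrite [RHS]mxE eqxx /=.
have [->|cb] := eqVneq c b; last by rewrite xc.
by rewrite -x1 (bigD1 b) //= big1 ?addr0.
Qed.

End Simplices.


Lemma ideal_completion_inj (R : realType) (M X : topologicalType) (e : M -> X)
  (V : set X) : ideal_completion R e V -> injective e.
Proof.
move=> [N [j [q [_ [[_ hj _ _] rj] [_ _ hq] -> _]]]] m m' /= /hq.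
case=> [|[bd _]]; first by apply: hj; rewrite inE.
by case: bd; rewrite -rj; exists m.
Qed.

Lemma ideal_completion_range (R : realType) (M X : topologicalType) (e : M -> X)
  (V : set X) : ideal_completion R e V -> range e = ~` V.
Proof.
move=> [N [j [q [_ [_ rj] [rq _ hq] -> ->]]]]; apply/seteqP; split=> w.
  move=> [m _ <-] [n bn] /= /hq.
  have jm : manifold_interior R (j m) by rewrite -rj; exists m.
  by case=> [nm|[_ /connected_component_sub]]; [apply: bn; rewrite nm|apply].
move=> hw; have [n _ nw] : range q w by rewrite rq.
have : manifold_interior R n.
  by apply: contrapT => bn; apply: hw; exists n.
by rewrite -rj => -[m _ mn]; exists m => //=; rewrite mn.
Qed.

(** * Developed vertices of paired faces *)

Section Development.
Variables (R : realType) (M : sphericalCR R) (T : CR_triangulation M).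

Local Notation P := (pairing T).
Implicit Types (s : 'I_(ntet (pairing T))) (i : 'I_4) (x y : 'rV[R]_4).

Lemma incl_inj : injective (Defs.incl T).
Proof.
case: (closed_or_ideal T) => [[_ [[_ h _ _] _]]|[_ /ideal_completion_inj//]].
by move=> m m'; apply: h; rewrite inE.
Qed.

Lemma face_pairing_rel s i x : face i x ->
  char_map s x = char_map (Defs.glue (s, i)).1 (relabel (Defs.glue (s, i)).2 x).
Proof.
move=> fx; have [_ _ _ h] := char_mapP T.
apply/(h _ _ _ _ fx.1 (relabel_simplex _ fx.1)).
by apply: rt_step; exists i.
Qed.

(** A gluing step permutes barycentric coordinates, so that only vertices are ever identified with
    vertices. *)
Lemma char_map_vertex s x s' a : simplex x ->
  char_map s x = char_map s' (vertex R a) -> is_vertex x.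
Proof.
move=> sx; have [_ _ _ h] := char_mapP T.
move=> /(h _ _ _ _ sx (vertex_simplex R a)).
suff H u v : clos_refl_trans _ (@glue_step R P) u v -> is_vertex v.2 -> is_vertex u.2.
  by move=> /H; apply; exists a.
elim=> {u v} [u v|//|u v w _ IH1 _ IH2 hw]; last exact/IH1/IH2.
by move=> [k [_ ->]] /= /relabel_vertex.
Qed.

(** In the ideal case the missing points are the vertices, which are extreme. This supplies the
    paths along which lifts of a face are compared. *)
Lemma non_ideal_segment s x y (t : R) : 0 <= t <= 1 ->
  non_ideal s x -> non_ideal s y -> non_ideal s (segment x y t).
Proof.
move=> ht [sx rx] [sy ry]; have sz := segment_simplex ht sx sy.
split => //; case: (closed_or_ideal T) => [[_ [_ ->]]//|[_ /ideal_completion_range]].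
move=> rE; move: rx ry; rewrite rE => rx ry [s' [a e]].
have := char_map_vertex sz e => /(segment_vertex ht sx sy)[] [b eb].
  by apply: rx; exists s, b; rewrite -eb.
by apply: ry; exists s, b; rewrite -eb.
Qed.

Lemma non_ideal_relabel s i x : face i x -> non_ideal s x ->
  non_ideal (Defs.glue (s, i)).1 (relabel (Defs.glue (s, i)).2 x).
Proof.
move=> fx [sx rx]; split; first exact: relabel_simplex.
by rewrite -(face_pairing_rel s fx).
Qed.

Lemma proj_tlift_glue s i x : face i x -> non_ideal s x ->
  Defs.proj (tlift (Defs.glue (s, i)).1 (relabel (Defs.glue (s, i)).2 x))
  = Defs.proj (tlift s x).
Proof.
move=> fx nx; apply: incl_inj.
rewrite tlift_proj; last exact: non_ideal_relabel.
by rewrite tlift_proj// -face_pairing_rel.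
Qed.

Lemma tlift_segment_continuous s x y : non_ideal s x -> non_ideal s y ->
  {within `[0, 1], continuous (tlift s \o segment x y)}.
Proof.
move=> nx ny; apply: (@within_continuous_comp _ _ _ _ (non_ideal s)).
- exact/continuous_subspaceT/segment_continuous.
- by move=> t; rewrite /= in_itv /= => ht; apply: non_ideal_segment.
- exact: (@tlift_continuous _ _ T s).
Qed.

(* The face without its ideal vertices is connected, so that two lifts of it
   differ by a single deck transformation. *)
Lemma deck_face s i : exists2 g, deck (@Defs.proj _ _ (develop T)) g &
  forall x, non_ideal s x -> face i x ->
    g (tlift (Defs.glue (s, i)).1 (relabel (Defs.glue (s, i)).2 x)) = tlift s x.
Proof.
(* Without a base point the condition on [g] is empty, and the identity serves. *)
have [[x0 [n0 f0]]|h] := pselect (exists x, non_ideal s x /\ face i x); last first.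
  exists id; first by split=> [y||]; [exact: cvg_id| |exists id; split=> // y; exact: cvg_id].
  by move=> x nx fx; case: h; exists x.
have [g dg g0] := deck_transitive (proj_tlift_glue f0 n0).
exists g => // x nx fx; have [gc gp _] := dg.
set s' := (Defs.glue (s, i)).1; set t := (Defs.glue (s, i)).2.
have n0' : non_ideal s' (relabel t x0) by exact: non_ideal_relabel.
have nx' : non_ideal s' (relabel t x) by exact: non_ideal_relabel.
(* Compare the two lifts along the segment from x0 to x; [g] was chosen to make them agree at x0. *)
rewrite -(segment1 x0 x) relabel_segment.
apply: (@covering_lift_unique _ _ _ _
  (g \o (tlift s' \o segment (relabel t x0) (relabel t x)))
  (tlift s \o segment x0 x) (proj_covering (develop T))).
- apply: (@within_continuous_comp _ _ _ _ setT) => //.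
    exact: tlift_segment_continuous.
  exact: continuous_subspaceT.
- exact: tlift_segment_continuous.
- move=> r hr; rewrite /= -[LHS]/((@Defs.proj _ _ (develop T) \o g) _) gp /= -relabel_segment.
  apply: proj_tlift_glue; last exact: non_ideal_segment.
  by apply: segment_face.
- by rewrite /= !segment0.
- by rewrite ler01 lexx.
Qed.

Lemma vert_face s i : exists2 h : S3 R -> S3 R, PU21 h &
  forall a, a != i ->
    vert s a = h (vert (Defs.glue (s, i)).1 ((Defs.glue (s, i)).2 a)).
Proof.
have [g dg hg] := deck_face s i.
by exists (hol g); [exact: hol_PU21|exact: vert_glue].
Qed.

Lemma BW_hom_beta : BW_hom (beta T) = 0.
Proof.
have e : 2 * BW_hom (beta T)
    = \sum_(s < ntet P) \sum_(i < 4) face_term (@face_inv R) (vert s) i.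
  rewrite /beta raddf_sum mulr_sumr; apply: eq_bigr => s _.
  rewrite !raddfD; have := volume_faces (vert_generic s).
  by rewrite /BW sum_face_term => ->.
have : 2 * BW_hom (beta T) = 0.
  rewrite e; apply: face_term_cancel.
  - exact: face_inv_swap.
  - exact: face_inv_cycle.
  move=> s i; have [h hP hv] := vert_face s i; exists h; last exact: hv.
  by move=> p q r; exact: face_inv_PU21.
by move/eqP; rewrite mulf_eq0 pnatr_eq0 => /eqP.
Qed.

End Development.

Theorem theorem3p12 (R : realType) :
  exists D : {additive preBloch (C R) -> R},
    (forall x : C R, x != 0 -> x != 1 -> D (bloch x) = BlochWigner x) /\
    (forall (M : sphericalCR R) (T : CR_triangulation M), D (beta T) = 0).
Proof.
exists (@BW_hom R); split; first exact: BWE.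
exact: BW_hom_beta.
Qed.
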